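(* Let $n\ge1$ and let $x=(x_1,\dots,x_n)$, $y=(y_1,\dots,y_n)$ be indeterminates. Then \begin{align*} A^{(2)}_{\mathrm{UU}}(4n;x,y;\zeta_4,\zeta_4,\zeta_4)&=2^{-2n^2+2n}\prod_{i=1}^n x_i^{-2n}y_i^{-2n}\prod_{i,j=1}^n(x_i^2+y_j^2)(1+x_i^2y_j^2),\\ A^{(2)}_{\mathrm{UU}}(4n;x,y;\zeta_6,\zeta_4,\zeta_4)&=3^{-n^2+n}\,\tilde{\mathrm O}_{4n+1}\big(\delta(n,n-1);x_1^2,\dots,x_n^2,y_1^2,\dots,y_n^2\big),\\ A^{(2)}_{\mathrm{UU}}(4n;x,x;\zeta_8,\zeta_4,\zeta_4)&=2^{-n^2+2n}\,\tilde{\mathrm O}_{2n+1}\big(\delta^2(n,n-2);x_1^2,\dots,x_n^2\big)\,\tilde{\mathrm O}_{2n+1}\big(\delta^2(n-1,n-1);x_1^2,\dots,x_n^2\big). \end{align*}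
   Context: $\sigma(t)=t-t^{-1}$, $\zeta_m=\exp(2\pi\sqrt{-1}/m)$. For parameters $a,b,c$ let $M_{\mathrm{UU}}(n;x,y;a,b,c)$ be the $n\times n$ matrix with entries $\dfrac{\sigma(b/y_j)\sigma(cx_i)}{\sigma(ax_i/y_j)}-\dfrac{\sigma(b/y_j)\sigma(c/x_i)}{\sigma(a/(x_iy_j))}-\dfrac{\sigma(by_j)\sigma(cx_i)}{\sigma(ax_iy_j)}+\dfrac{\sigma(by_j)\sigma(c/x_i)}{\sigma(ay_j/x_i)}$, let $F_{\mathrm V}(n;x,y;a)=\dfrac{\prod_{i,j=1}^n\sigma(ax_i/y_j)\sigma(ay_j/x_i)\sigma(ax_iy_j)\sigma(a/(x_iy_j))}{\prod_{1\le i<j\le n}\sigma(x_j/x_i)\sigma(y_i/y_j)\prod_{1\le i\le j\le n}\sigma(1/(x_ix_j))\sigma(y_iy_j)}$, and $A^{(2)}_{\mathrm{UU}}(4n;x,y;a,b,c)=\sigma(a)^{-2n^2-n}\sigma(b/a)^{-n}\sigma(c/a)^{-n}\sigma(a^2)^{2n}F_{\mathrm V}(n;x,y;a)\det M_{\mathrm{UU}}(n;x,y;a,b,c)$; with $y=x$ for the last identity. Sequences: for $r\in\mathbb Z$, $\delta(r)$ is $(r,r-1,\dots)$ consisting of all $r-k\ge0$ and $\delta^2(r)=(r,r-2,\dots)$ of all $r-2k\ge0$ ($k\in\mathbb Z_{\ge0}$), empty if $r<0$; $\delta(r,s)$, $\delta^2(r,s)$ arrange the entries of the two sequences together in non-increasing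 order. As the index of a character in $N$ variables, such a sequence is replaced by its first $N$ entries (padded with zeros if shorter). For a partition $\lambda$ of length $\le N$ and $z=(z_1,\dots,z_N)$ with $z_i=w_i^2$: $\tilde{\mathrm O}_{2N+1}(\lambda;z)=\det\big(z_i^{\lambda_j+N-j+1/2}-z_i^{-(\lambda_j+N-j+1/2)}\big)/\det\big(z_i^{N-j+1/2}-z_i^{-(N-j+1/2)}\big)$, where $z_i^{r}$ for half-integer $r$ means $w_i^{2r}$.
   Formalization: At a=b=c=ζ_4 the defining formula has factors 0 and 1/0 and its limit depends on direction; the first identity is read as the value at a=ζ_4 of the rational function of a obtained by fixing b=c=ζ_4. *)

(* Defs.v *)
From HB Require Import structures.
From mathcomp Require Import all_boot all_order all_algebra.
From mathcomp Require Import fraction complex.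
From mathcomp Require Import mpoly.
From mathcomp Require Import reals.
From mathcomp Require trigo.

Set Implicit Arguments.
Unset Strict Implicit.
Unset Printing Implicit Defensive.

Import Order.TTheory GRing.Theory Num.Theory.
Local Open Scope ring_scope.

(* exp(2 pi sqrt(-1) / m), written out with Euler's formula since the library
   has no complex exponential *)
Definition zeta (R : realType) (m : nat) : R[i] :=
  let t : R := 2%:R * trigo.pi / m%:R in Complex (trigo.cos t) (trigo.sin t).

Section PartitionFunction.
Variable K : fieldType.
Implicit Types (n : nat) (a b c t : K).

Definition sigma t : K := t - t^-1.

Definition MUU n (x y : 'I_n -> K) a b c : 'M[K]_n :=
  \matrix_(i, j)
    (sigma (b / y j) * sigma (c * x i) / sigma (a * x i / y j)
     - sigma (b / y j) * sigma (c / x i) / sigma (a / (x i * y j))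
     - sigma (b * y j) * sigma (c * x i) / sigma (a * x i * y j)
     + sigma (b * y j) * sigma (c / x i) / sigma (a * y j / x i)).

Definition FV n (x y : 'I_n -> K) a : K :=
  (\prod_(i < n) \prod_(j < n)
     (sigma (a * x i / y j) * sigma (a * y j / x i)
      * sigma (a * x i * y j) * sigma (a / (x i * y j))))
  / ((\prod_(i < n) \prod_(j < n | (i < j)%N)
        (sigma (x j / x i) * sigma (y i / y j)))
     * (\prod_(i < n) \prod_(j < n | (i <= j)%N)
        (sigma (1 / (x i * x j)) * sigma (y i * y j)))).

Definition A2UU n (x y : 'I_n -> K) a b c : K :=
  sigma a ^- (2 * n ^ 2 + n) * sigma (b / a) ^- n * sigma (c / a) ^- n
  * sigma (a ^+ 2) ^+ (2 * n) * FV x y a * \det (MUU x y a b c).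

(* The character \tilde O_{2N+1}(la; z) at z_i = w_i^2; the rows and columns
   are numbered from 0, so that the exponent of w_i in column j is
   2 (la_(j+1) + N - (j+1) + 1/2).  Reading la through nth 0 at the indices
   below N truncates la to its first N entries or pads it with zeros. *)
Definition Oalt N (la : seq nat) (w : 'I_N -> K) : 'M[K]_N :=
  \matrix_(i, j) let e := (2 * (nth 0 la j + (N - j.+1)) + 1)%N in
                 w i ^+ e - w i ^- e.

Definition Otilde N (la : seq nat) (w : 'I_N -> K) : K :=
  \det (Oalt la w) / \det (Oalt [::] w).

Definition fcat n m (x : 'I_n -> K) (y : 'I_m -> K) (k : 'I_(n + m)) : K :=
  match split k with inl i => x i | inr j => y j end.

(* The rational function f is regular at a and takes the value v there. *)
Definition has_value_at (f : {fraction {poly K}}) (a v : K) : Prop :=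
  exists p q : {poly K},
    [/\ q.[a] != 0, f = tofrac p / tofrac q & v = p.[a] / q.[a]].

Lemma has_value_at_unique f a v1 v2 :
  has_value_at f a v1 -> has_value_at f a v2 -> v1 = v2.
Proof.
move=> [p1 [q1 [h1 -> ->]]] [p2 [q2 [h2 /eqP e ->]]].
have nz (q : {poly K}) : q.[a] != 0 -> tofrac q != 0.
  by move=> hq; rewrite tofrac_eq0; apply: contra_neq hq => ->; rewrite horner0.
move: e; rewrite eqr_div ?nz // -!tofracM tofrac_eq => /eqP e.
by apply/eqP; rewrite eqr_div // -!hornerM e.
Qed.

Definition ratcst (t : K) : {fraction {poly K}} := tofrac t%:P.
Definition ratX : {fraction {poly K}} := tofrac 'X.

End PartitionFunction.

Definition delta (r : int) : seq nat :=
  if r is Posz m then [seq (m - k)%N | k <- iota 0 m.+1] else [::].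
Definition delta2 (r : int) : seq nat :=
  if r is Posz m then [seq (m - 2 * k)%N | k <- iota 0 m./2.+1] else [::].

Definition delta_pair (r s : int) : seq nat := sort geq (delta r ++ delta s).
Definition delta2_pair (r s : int) : seq nat := sort geq (delta2 r ++ delta2 s).

Section Indeterminates.
Variables (R : realType) (n : nat).

(* C(x_1, ..., x_n, y_1, ..., y_n) *)
Definition ratfun : fieldType := {fraction {mpoly R[i][n + n]}}.

Definition cst (t : R[i]) : ratfun := tofrac (mpolyC (n + n) t).
Definition xvar (i : 'I_n) : ratfun := tofrac ('X_(lshift n i) : {mpoly R[i][n + n]}).
Definition yvar (j : 'I_n) : ratfun := tofrac ('X_(rshift n j) : {mpoly R[i][n + n]}).

End Indeterminates.

(* Main.v *)
Require Import Defs.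
From mathcomp Require Import all_boot all_order all_algebra.
From mathcomp Require Import fraction complex mpoly.
From mathcomp Require Import reals.
From mathcomp Require trigo.
From mathcomp Require Import perm ring zify.
Import Order.TTheory Num.Theory.
Import GRing.Theory.
Local Open Scope ring_scope.

Set Implicit Arguments.
Unset Strict Implicit.
Unset Printing Implicit Defensive.

(* Put X = x^2 + x^-2, Y = y^2 + y^-2 and t = (a + 1/a)^2.  When b and c are
   square roots of -1, the entry of M_UU becomes, up to row and column factors,
     (t + X + Y) / q(X, Y),   q = t^2 - t (4 + X Y) + (X + Y)^2,
   where q is the product of the four sigma's in the numerator of F_V.
   - t = 0 (a = zeta_4): this is 1 / (X + Y), a Cauchy determinant.
   - t = 1 (a = zeta_6): it is (g(X) - g(Y)) / (f(X) - f(Y)) with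
     f(X) = X^3 - 3 X = x^6 + x^-6 and g(X) = X^2 + X - 1.  By Lagrange
     interpolation such a determinant is a 2n x 2n determinant with columns
     f^k, g f^k, and as g = (x^5 - x^-5) / (x - x^-1), a unitriangular change
     of columns turns these into the alternants of exponents 1, 5, 7, 11, ...
   - t = 2 (a = zeta_8) with y = x: it is (b_i + b_j) / (a_i + a_j) with
     a = x^4 + x^-4 and b = X + 1.  If G is the matrix of multiplication by b in
     the basis 1, a, a^2, ... and S the diagonal matrix of signs (-1)^k, the
     determinant is that of G S + S G, which is block diagonal for the parity of
     k; the two blocks give the alternants of exponents 1, 7, 9, 15, ... and
     3, 5, 11, 13, ... *)

(** * Cauchy and block Vandermonde determinants *)

Section Determinants.
Variable K : fieldType.
Implicit Types n : nat.

Definition vand n (a : 'I_n -> K) : 'M[K]_n := \matrix_(i, k) a i ^+ k.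

Lemma det_vand n (a : 'I_n -> K) :
  \det (vand a) = \prod_(i < n) \prod_(j < n | (i < j)%N) (a j - a i).
Proof.
rewrite -det_tr.
have -> : (vand a)^T = Vandermonde n (\row_i a i).
  by apply/matrixP => i j; rewrite !mxE.
rewrite det_Vandermonde; apply: eq_bigr => i _.
by apply: eq_bigr => j _; rewrite !mxE.
Qed.

Lemma det_vand_neq0 n (a : 'I_n -> K) : injective a -> \det (vand a) != 0.
Proof.
move=> a_inj; rewrite det_vand; apply/prodf_neq0 => i _; apply/prodf_neq0 => j.
by move=> lt_ij; rewrite subr_eq0 (inj_eq a_inj) -val_eqE gtn_eqF.
Qed.

Definition pair_sign n : K := \prod_(i < n) \prod_(j < n | (i < j)%N) (-1).

Lemma pair_sign_sqr n : pair_sign n * pair_sign n = 1.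
Proof.
rewrite /pair_sign -big_split big1 //= => i _.
by rewrite -big_split big1 //= => j _; rewrite mulrNN mulr1.
Qed.

Lemma pair_sign_neq0 n : pair_sign n != 0.
Proof.
apply: contraTneq (oner_neq0 K) => e.
by rewrite -(pair_sign_sqr n) e mulr0 eqxx.
Qed.

Lemma prod_neq_pairs n (F : 'I_n -> 'I_n -> K) :
  \prod_i \prod_(j | j != i) F i j
  = \prod_(i < n) \prod_(j < n | (i < j)%N) (F i j * F j i).
Proof.
transitivity (\prod_(i < n) ((\prod_(j < n | (i < j)%N) F i j)
                            * \prod_(j < n | (j < i)%N) F i j)).
  apply: eq_bigr => i _; rewrite (bigID (fun j : 'I_n => (i < j)%N)) /=.
  congr (_ * _); apply: eq_bigl => j.
    by rewrite -val_eqE /= neq_ltn; case: ltngtP.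
  by rewrite -val_eqE /= neq_ltn; case: ltngtP.
rewrite big_split /= [X in _ * X](exchange_big_dep xpredT) //= -big_split /=.
by apply: eq_bigr => i _; rewrite big_split.
Qed.

Lemma prod_neq_subr n (a : 'I_n -> K) :
  \prod_i \prod_(k | k != i) (a i - a k) = pair_sign n * \det (vand a) ^+ 2.
Proof.
rewrite prod_neq_pairs det_vand expr2 /pair_sign -!big_split /=.
apply: eq_bigr => i _; rewrite -!big_split /=; apply: eq_bigr => j _; ring.
Qed.

Lemma prod_neq_subr_neq0 n (a : 'I_n -> K) i :
  injective a -> \prod_(k | k != i) (a i - a k) != 0.
Proof.
move=> a_inj; apply/prodf_neq0 => k ne_ki.
by rewrite subr_eq0 (inj_eq a_inj) eq_sym.
Qed.

(** Both sides are polynomials in [t] of degree less than [n], and they agree at the [n] distinct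
    nodes [a j]. *)
Lemma lagrange_interp n (a : 'I_n -> K) (k : 'I_n) (t : K) :
  injective a ->
  \sum_i a i ^+ k * (\prod_(m | m != i) (t - a m)
                     / \prod_(m | m != i) (a i - a m)) = t ^+ k.
Proof.
move=> a_inj.
pose b i := a i ^+ k / \prod_(m | m != i) (a i - a m).
pose Q : {poly K} := \sum_i b i *: \prod_(m | m != i) ('X - (a m)%:P).
have hornerQ s : Q.[s] = \sum_i a i ^+ k * (\prod_(m | m != i) (s - a m)
                     / \prod_(m | m != i) (a i - a m)).
  rewrite horner_sum; apply: eq_bigr => i _.
  rewrite hornerZ horner_prod /b mulrAC mulrA.
  by congr (_ * _ / _); apply: eq_bigr => m _; rewrite !hornerE.
suff /eqP eqQ : Q == 'X^k by rewrite -hornerQ eqQ !hornerE.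
rewrite -subr_eq0; apply/eqP; apply: (@roots_geq_poly_eq0 _ _ (codom a)).
- apply/allP => _ /codomP[j ->]; rewrite /root !hornerE hornerQ.
  rewrite (bigD1 j) //= divff ?prod_neq_subr_neq0 // mulr1 big1 ?addr0 ?subrr //.
  move=> i ne_ij; rewrite (bigD1 j) /=; last by rewrite eq_sym.
  by rewrite subrr !mul0r mulr0.
- by rewrite map_inj_uniq ?enum_uniq.
rewrite size_map size_enum_ord; apply: (leq_trans (size_polyD _ _)).
rewrite geq_max size_polyN size_polyXn ltn_ord andbT.
apply: (leq_trans (size_sum _ _ _)); apply/bigmax_leqP => i _.
apply: (leq_trans (size_scale_leq _ _)).
rewrite -big_filter size_prod_XsubC -sum1_size big_filter sum1_card.
by rewrite (cardC1 i) card_ord (ltn_predK (ltn_ord i)).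
Qed.

(** Row [j] holds the values at [c j] of the Lagrange basis polynomials for the nodes [a]. Written
    this way it is a Cauchy matrix with scaled rows and columns. *)
Definition lagrange_mx n (a c : 'I_n -> K) : 'M[K]_n :=
  \matrix_(j, i) (\prod_k (c j - a k) / \prod_(k | k != i) (a i - a k)
                  / (c j - a i)).

Lemma lagrange_mxP n (a c : 'I_n -> K) :
  injective a -> (forall i j, c j != a i) ->
  lagrange_mx a c *m vand a = vand c.
Proof.
move=> a_inj ne_ca; apply/matrixP => j k; rewrite !mxE.
rewrite -(lagrange_interp k (c j) a_inj); apply: eq_bigr => i _; rewrite !mxE.
rewrite [RHS]mulrC; congr (_ * _).
rewrite (bigD1 i) //=; have := ne_ca i j; rewrite -subr_eq0 => nz.
by field; rewrite nz prod_neq_subr_neq0.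
Qed.

Lemma det_scale_rows_cols n (r s : 'I_n -> K) (M : 'M[K]_n) :
  \det (\matrix_(i, j) (r i * s j * M i j))
  = (\prod_i r i) * (\prod_i s i) * \det M.
Proof.
have -> : \matrix_(i, j) (r i * s j * M i j)
          = diag_mx (\row_i r i) *m M *m diag_mx (\row_i s i).
  apply/matrixP => i j; rewrite mul_mx_diag mul_diag_mx !mxE; ring.
rewrite !det_mulmx !det_diag mulrAC.
by congr (_ * _ * _); apply: eq_bigr => i _; rewrite mxE.
Qed.

(** The row scalings multiply to the product of all [c j - a i]. The column scalings multiply to the
    inverse of the product of all [a i - a k] with [k != i], which is [pair_sign n] times a squared
    Vandermonde determinant. *)
Lemma det_lagrange_diff n (a b c d : 'I_n -> K) :
  injective a ->
  \det (\matrix_(j, i) ((d j - b i) * lagrange_mx a c j i))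
  = pair_sign n * (\prod_j \prod_i (c j - a i)) / \det (vand a) ^+ 2
    * \det (\matrix_(j, i) ((d j - b i) / (c j - a i))).
Proof.
move=> a_inj.
have -> : \matrix_(j, i) ((d j - b i) * lagrange_mx a c j i)
  = \matrix_(j, i) ((\prod_k (c j - a k)) * (\prod_(k | k != i) (a i - a k))^-1
     * (\matrix_(j, i) ((d j - b i) / (c j - a i))) j i).
  by apply/matrixP => j i; rewrite !mxE; ring.
rewrite det_scale_rows_cols prodfV prod_neq_subr invfM; congr (_ * _).
have -> : (pair_sign n)^-1 = pair_sign n.
  by apply: (mulfI (pair_sign_neq0 n)); rewrite mulfV ?pair_sign_sqr ?pair_sign_neq0.
by ring.
Qed.

(** Take determinants in [lagrange_mx a v *m vand a = vand v] for [a = - u]; the interpolation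
    matrix is then a scaled Cauchy matrix. *)
Lemma det_cauchy n (u v : 'I_n -> K) :
  injective u -> (forall i j, u i + v j != 0) ->
  \det (\matrix_(i, j) (u i + v j)^-1) * \prod_i \prod_j (u i + v j)
  = \det (vand u) * \det (vand v).
Proof.
move=> u_inj nz.
pose a i := - u i.
have a_inj : injective a by move=> i j /oppr_inj /u_inj.
have ne_va i j : v j != a i by rewrite -subr_eq0 /a opprK addrC.
have := congr1 determinant (lagrange_mxP a_inj ne_va); rewrite det_mulmx.
have -> : lagrange_mx a v = \matrix_(j, i) (((fun=> 1) j - (fun=> 0) i) * lagrange_mx a v j i).
  by apply/matrixP => j i; rewrite !mxE subr0 mul1r.
rewrite det_lagrange_diff //.
have -> : \det (\matrix_(j, i) ((1 - 0) / (v j - a i))) = \det (\matrix_(i, j) (u i + v j)^-1).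
  rewrite -det_tr; congr (\det _); apply/matrixP => i j.
  by rewrite !mxE subr0 mul1r /a opprK addrC.
have -> : \prod_j \prod_i (v j - a i) = \prod_i \prod_j (u i + v j).
  by rewrite exchange_big; apply: eq_bigr => i _; apply: eq_bigr => j _;
     rewrite /a opprK addrC.
have eq_a : \det (vand a) = pair_sign n * \det (vand u).
  rewrite !det_vand /pair_sign -big_split; apply: eq_bigr => i _ /=.
  by rewrite -big_split; apply: eq_bigr => j _ /=; rewrite /a; ring.
have nzu := det_vand_neq0 u_inj.
move: (pair_sign_neq0 n) nzu; rewrite eq_a.
set s := pair_sign n; set D := \det (vand u); set P := \prod_i _; set C := \det _.
by move=> nzs nzD <-; field; rewrite nzD nzs.
Qed.

(** The columns are the powers f^k followed by the products g f^k, taken at two groups of [n] points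
    where f has the values [a], [c] and g the values [b], [d]. *)
Definition block_vand n (a b c d : 'I_n -> K) : 'M[K]_(n + n) :=
  block_mx (vand a) (diag_mx (\row_i b i) *m vand a)
           (vand c) (diag_mx (\row_i d i) *m vand c).

(** Block elimination: subtracting [L] times the upper block row from the lower one leaves the Schur
    complement [(D *m L - L *m B) *m vand a], whose first factor has the shape treated in
    [det_lagrange_diff]. *)
Lemma det_block_vand n (a b c d : 'I_n -> K) :
  injective a -> (forall i j, c j != a i) ->
  \det (block_vand a b c d)
  = pair_sign n * (\prod_j \prod_i (c j - a i))
    * \det (\matrix_(j, i) ((d j - b i) / (c j - a i))).
Proof.
move=> a_inj ne_ca; set L := lagrange_mx a c.
pose B := diag_mx (\row_i b i); pose D := diag_mx (\row_i d i).
have LV : L *m vand a = vand c by exact: lagrange_mxP.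
have -> : block_vand a b c d
  = block_mx 1%:M 0 L 1%:M
    *m block_mx (vand a) (B *m vand a) 0 ((D *m L - L *m B) *m vand a).
  rewrite mulmx_block !mul0mx !mulmx0 !mul1mx !addr0 LV /block_vand.
  by rewrite mulmxBl -!mulmxA LV addrC subrK.
rewrite det_mulmx det_lblock det_ublock !det1 !mul1r det_mulmx.
have -> : D *m L - L *m B = \matrix_(j, i) ((d j - b i) * L j i).
  by apply/matrixP => j i; rewrite mul_mx_diag mul_diag_mx !mxE; ring.
rewrite det_lagrange_diff //; have nz := det_vand_neq0 a_inj.
by field.
Qed.

End Determinants.

(** * Block Vandermonde matrices with interleaved columns *)

Section Interleaving.
Variable K : fieldType.

(** The columns 1, g, f, g f, f^2, ... come in the order of increasing exponents of the alternants.
    For f = X^2 and g = X this is the ordinary Vandermonde matrix of X. *)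
Definition interleaved_vand n (f g : 'I_(n + n) -> K) : 'M[K]_(n + n) :=
  \matrix_(i, j) (f i ^+ j./2 * g i ^+ odd j).

Lemma ord_half_subproof n (j : 'I_(n + n)) : (j./2 < n)%N.
Proof. by have := ltn_ord j; lia. Qed.

Definition ord_half n (j : 'I_(n + n)) : 'I_n := Ordinal (ord_half_subproof j).

Definition deinterleave n (j : 'I_(n + n)) : 'I_(n + n) :=
  if odd j then rshift n (ord_half j) else lshift n (ord_half j).

Lemma deinterleave_inj n : injective (@deinterleave n).
Proof.
move=> i j /(congr1 val); rewrite /deinterleave => eq_ij; apply: val_inj.
have := ltn_ord i; have := ltn_ord j; move: eq_ij.
by case: ifP => oi; case: ifP => oj /=; lia.
Qed.

(* The sign of the permutation does not matter: it will cancel against the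
   same sign for a genuine Vandermonde matrix. *)
Lemma det_interleaved_vand n : exists2 e : K, e != 0 &
  forall f g : 'I_(n + n) -> K, \det (interleaved_vand f g)
  = e * \det (block_vand (fun i => f (lshift n i)) (fun i => g (lshift n i))
                         (fun i => f (rshift n i)) (fun i => g (rshift n i))).
Proof.
pose s := perm (@deinterleave_inj n).
exists (\det (perm_mx s^-1)); first by rewrite det_perm signr_eq0.
move=> f g; rewrite mulrC -det_mulmx -col_permE; congr (\det _).
apply/matrixP => i j; rewrite !mxE permE /deinterleave.
case: (split_ordP i) => i0 ->; case: ifP => oj; rewrite ?split_lshift ?split_rshift.
all: rewrite ?(row_mxEl, row_mxEr) ?mul_diag_mx !mxE /= ?expr1 ?expr0 ?mulr1 //.
all: by rewrite mulrC.
Qed.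

End Interleaving.

(** * Unitriangular changes of columns *)

Section TriangularChange.
Variables (K : fieldType) (T : Type).
Implicit Types (H E : nat -> T -> K) (v f : T -> K).

Definition in_span H j v :=
  exists c : nat -> K, forall p, v p = \sum_(k < j) c k * H k p.

(** Required for every [j], this makes the passage from [H] to [E] unitriangular. *)
Definition same_lead E H j := in_span H j (fun p => E j p - H j p).

Lemma in_span_lin H j v1 v2 t1 t2 : in_span H j v1 -> in_span H j v2 ->
  in_span H j (fun p => t1 * v1 p + t2 * v2 p).
Proof.
move=> [c1 e1] [c2 e2]; exists (fun k => t1 * c1 k + t2 * c2 k) => p.
rewrite e1 e2 !mulr_sumr -big_split; apply: eq_bigr => k _ /=; ring.
Qed.

Lemma in_span_ext H j v1 v2 : v1 =1 v2 -> in_span H j v1 -> in_span H j v2.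
Proof. by move=> e [c h]; exists c => p; rewrite -e. Qed.

Lemma in_span_widen H j m v : (j <= m)%N -> in_span H j v -> in_span H m v.
Proof.
move=> le_jm [c e]; exists (fun k => if (k < j)%N then c k else 0) => p.
rewrite e (big_ord_widen m (fun k => c k * H k p) le_jm) big_mkcond.
by apply: eq_bigr => k _; case: ifP => //; rewrite mul0r.
Qed.

Lemma in_span_basis H j : in_span H j.+1 (H j).
Proof.
exists (fun k => (k == j)%:R) => p.
rewrite big_ord_recr /= eqxx mul1r big1 ?add0r // => k _.
by rewrite ltn_eqF ?mul0r.
Qed.

Lemma in_span_mul H f j v : (forall k p, H k.+2 p = f p * H k p) ->
  in_span H j v -> in_span H j.+2 (fun p => f p * v p).
Proof.
move=> eH [c e]; exists (fun k => if k is m.+2 then c m else 0) => p.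
rewrite !big_ord_recl /= !mul0r !add0r e mulr_sumr.
by apply: eq_bigr => k _; rewrite eH /=; ring.
Qed.

(** One has E_{k+4} - H_{k+4} = f (E_{k+2} - H_{k+2}) - t E_{k+2} - E_k. Multiplication by f raises
    the span by two indices, and the last two terms involve no H beyond index k+2. *)
Lemma same_lead_rec E H f t :
  (forall k p, H k.+2 p = f p * H k p) ->
  (forall k p, E k.+4 p = (f p - t) * E k.+2 p - E k p) ->
  (forall k, (k < 4)%N -> same_lead E H k) ->
  forall k, same_lead E H k.
Proof.
move=> eH eE small k.
(* The recurrence reaches back four indices, so the induction carries four consecutive cases. *)
suff: same_lead E H k /\ same_lead E H k.+1 /\ same_lead E H k.+2
      /\ same_lead E H k.+3 by case.
elim: k => [|k [h0 [h1 [h2 h3]]]]; first by do !split; apply: small.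
do 3!split => //.
have spanE j m : (j < m)%N -> same_lead E H j -> in_span H m (E j).
  move=> lt_jm h; apply: (in_span_widen lt_jm).
  apply: (in_span_ext (v1 := fun p => 1 * (E j p - H j p) + 1 * H j p)).
    by move=> p; ring.
  by apply: in_span_lin; [apply: in_span_widen h | apply: in_span_basis].
have h2' := in_span_mul eH h2.
have := in_span_lin 1 1 h2'
  (in_span_lin (- t) (-1) (spanE k.+2 k.+4 (ltnW (ltnSn _)) h2)
                   (spanE k k.+4 (ltnW (ltnW (ltnW (ltnSn _)))) h0)).
by apply: in_span_ext => p; rewrite eE (eH k.+2); ring.
Qed.

End TriangularChange.

(** The matrix of [E] is that of [H] times the transpose of a lower unitriangular matrix. *)
Lemma det_same_lead (K : fieldType) N (E H : nat -> 'I_N -> K) :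
  (forall k, same_lead E H k) ->
  \det (\matrix_(i, j) E j i) = \det (\matrix_(i < N, j < N) H j i).
Proof.
move=> lead.
have [c hc] := @fin_all_exists 'I_N (fun=> nat -> K)
  (fun j c => forall p, E j p - H j p = \sum_(k < j) c k * H k p)
  (fun j => lead j).
pose A : 'M[K]_N := \matrix_(j, k)
  (if k == j then 1 else if (k < j)%N then c j k else 0).
have detA : \det A = 1.
  rewrite det_trig; first by rewrite big1 // => i _; rewrite mxE eqxx.
  apply/is_trig_mxP => i j lt_ij; rewrite mxE -val_eqE.
  by rewrite (gtn_eqF lt_ij) ltnNge (ltnW lt_ij).
have -> : \matrix_(i, j) E j i = (\matrix_(i, j) H j i) *m A^T.
  apply/matrixP => i j; rewrite !mxE -[LHS](subrK (H j i)) hc.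
  rewrite (big_ord_widen N (fun k => c j k * H k i) (ltnW (ltn_ord j))).
  rewrite big_mkcond [RHS](bigD1 j) //= !mxE eqxx mulr1 addrC; congr (_ + _).
  rewrite (bigD1 j) //= ltnn add0r; apply: eq_bigr => k ne_kj.
  by rewrite !mxE (negPf ne_kj); case: ifP => _; rewrite ?mulr0 // mulrC.
by rewrite det_mulmx det_tr detA mulr1.
Qed.

(** * Factorization of a determinant according to parity *)

Section ParityFactorization.
Variable K : fieldType.

(** The block matrix [M] below has two triangular factorizations, one for each side. *)
Lemma det_1DmulC n (A B : 'M[K]_n) :
  \det (1%:M + A *m B) = \det (1%:M + B *m A).
Proof.
pose M := block_mx 1%:M A (- B) 1%:M.
have e1 : M = block_mx 1%:M 0 (- B) 1%:M *m block_mx 1%:M A 0 (1%:M + B *m A).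
  rewrite mulmx_block !mul0mx !mul1mx !mulmx1 !addr0 ?mulmx0 ?addr0.
  by rewrite mulNmx addrC addrK.
have e2 : M = block_mx 1%:M A 0 1%:M *m block_mx (1%:M + A *m B) 0 (- B) 1%:M.
  rewrite mulmx_block !mul0mx !mul1mx !mulmx1 ?mulmx0 ?add0r ?addr0.
  by rewrite mulmxN addrK.
have := congr1 determinant e1; rewrite {1}e2 !det_mulmx !det_ublock !det_lblock.
by rewrite !det1 !mul1r !mulr1.
Qed.

Variable n : nat.
Implicit Types a b : 'I_n -> K.

(** Complementary projections onto the coordinates of even and odd index; [Ev - Od] is the matrix S
    of signs. *)
Let Ev : 'M[K]_n := diag_mx (\row_k (~~ odd k)%:R).
Let Od : 'M[K]_n := diag_mx (\row_k (odd k)%:R).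

Let EvD : Ev + Od = 1%:M.
Proof.
apply/matrixP => i j; rewrite !mxE; case: eqP => _; rewrite ?mulr0n ?addr0 //.
by case: odd; rewrite ?add0r ?addr0.
Qed.

Let EvEv : Ev *m Ev = Ev.
Proof.
by apply/matrixP => i j; rewrite mul_diag_mx !mxE; case: odd => /=;
   rewrite ?mul0r ?mul1r ?mul0rn.
Qed.

Let OdOd : Od *m Od = Od.
Proof.
by apply/matrixP => i j; rewrite mul_diag_mx !mxE; case: odd => /=;
   rewrite ?mul0r ?mul1r ?mul0rn.
Qed.

Let EvOd : Ev *m Od = 0.
Proof.
by apply/matrixP => i j; rewrite mul_diag_mx !mxE; case: odd => /=;
   rewrite ?mul0r ?mul1r ?mul0rn.
Qed.

Let OdEv : Od *m Ev = 0.
Proof.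
by apply/matrixP => i j; rewrite mul_diag_mx !mxE; case: odd => /=;
   rewrite ?mul0r ?mul1r ?mul0rn.
Qed.

Lemma det_Sign : \det (Ev - Od) = pair_sign K n.
Proof.
rewrite -[Ev - Od]/(Ev + - Od) -raddfN -raddfD det_diag /pair_sign.
rewrite [RHS](exchange_big_dep xpredT) //=; apply: eq_bigr => j _.
rewrite -(big_ord_widen n (fun=> -1) (ltnW (ltn_ord j))) prodr_const card_ord.
by rewrite !mxE -signr_odd; case: odd; rewrite ?subr0 ?sub0r.
Qed.

(** In G S + S G the blocks that mix parities cancel, and the diagonal blocks are doubled up to
    sign. The two factors on the right are these diagonal blocks up to unipotent matrices. *)
Lemma det_parity_mx (G : 'M[K]_n) :
  \det (G *m (Ev - Od) + (Ev - Od) *m G)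
  = 2%:R ^+ n * \det (Ev - Od) * \det (Ev + G *m Od) * \det (G *m Ev + Od).
Proof.
have EE M : M *m Ev *m Ev = M *m Ev by rewrite -mulmxA EvEv.
have OO M : M *m Od *m Od = M *m Od by rewrite -mulmxA OdOd.
have EO M : M *m Ev *m Od = 0 by rewrite -mulmxA EvOd mulmx0.
have OE M : M *m Od *m Ev = 0 by rewrite -mulmxA OdEv mulmx0.
pose simp := (mulmxDl, mulmxDr, mulmxN, mulNmx, mulmxA, mulmx1, mul1mx,
              EvEv, OdOd, EvOd, OdEv, EE, OO, EO, OE, mul0mx, mulmx0,
              addr0, add0r, oppr0).
(* Here [A *m B] has square zero, so the matrix is unipotent. *)
have det_nil (A B : 'M[K]_n) : B *m A = 0 -> \det (1%:M + A *m B) = 1 :> K.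
  by move=> e; rewrite det_1DmulC e addr0 det1.
have {1}-> : G = (Ev + Od) *m G *m (Ev + Od) by rewrite EvD mul1mx mulmx1.
have {2}-> : G = (Ev + Od) *m G *m (Ev + Od) by rewrite EvD mul1mx mulmx1.
have -> : (Ev + Od) *m G *m (Ev + Od) *m (Ev - Od)
          + (Ev - Od) *m ((Ev + Od) *m G *m (Ev + Od))
   = 2%:R *: ((Ev + Od *m G *m Od) *m (Od + Ev *m G *m Ev) *m (Ev - Od)).
  rewrite !simp; apply/matrixP => i j; rewrite !mxE; ring.
have -> : Ev + G *m Od = (Ev + Od *m G *m Od) *m (1%:M + Ev *m (G *m Od)).
  rewrite !simp -addrA [_ + Ev *m _ *m _]addrC -!mulmxDl EvD mul1mx //.
have -> : G *m Ev + Od = (Od + Ev *m G *m Ev) *m (1%:M + Od *m (G *m Ev)).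
  by rewrite !simp -addrA -!mulmxDl EvD mul1mx addrC.
rewrite detZ !det_mulmx !det_nil; first by ring.
  by rewrite !simp.
by rewrite !simp.
Qed.

(** Interpolation [L] from the nodes [a] to the nodes [- a] satisfies L V = V S, because (-a)^k =
    (-1)^k a^k. With G = V^-1 B V this conjugates B L + L B, a scaled form of the matrix on the
    left, to G S + S G. As V G = B V, the two parity factors become the matrices on the right. *)
Lemma det_parity_factor a b : injective a -> (forall i j, a i + a j != 0) ->
  (\prod_i \prod_j (a i + a j))
  * \det (\matrix_(i, j) ((b i + b j) / (a i + a j)))
  = 2%:R ^+ n * \det (\matrix_(i < n, k < n) (a i ^+ k * b i ^+ odd k))
    * \det (\matrix_(i < n, k < n) (a i ^+ k * b i ^+ ~~ odd k)).
Proof.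
move=> a_inj nz; pose B := diag_mx (\row_i b i); pose V := vand a.
have Vunit : V \in unitmx by rewrite unitmxE unitfE det_vand_neq0.
pose G := invmx V *m B *m V; pose L := lagrange_mx a (fun j => - a j).
have VG : V *m G = B *m V by rewrite /G !mulmxA mulmxV // mul1mx.
have LV : L *m V = V *m (Ev - Od).
  rewrite lagrange_mxP //; last by move=> i j; rewrite -subr_eq0 -opprD oppr_eq0 addrC.
  apply/matrixP => j k.
  rewrite -[Ev - Od]/(Ev + - Od) -raddfN -raddfD mul_mx_diag !mxE exprNn.
  by rewrite mulrC -signr_odd; case: odd; rewrite ?subr0 ?sub0r.
have -> : \matrix_(i < n, k < n) (a i ^+ k * b i ^+ odd k) = V *m (Ev + G *m Od).
  rewrite mulmxDr mulmxA VG; apply/matrixP => i k.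
  rewrite !mul_mx_diag mul_diag_mx !mxE -/V.
  by case: odd; rewrite /= ?expr0 ?expr1; ring.
have -> : \matrix_(i < n, k < n) (a i ^+ k * b i ^+ ~~ odd k) = V *m (G *m Ev + Od).
  rewrite mulmxDr mulmxA VG; apply/matrixP => i k.
  rewrite !mul_mx_diag mul_diag_mx !mxE -/V.
  by case: odd; rewrite /= ?expr0 ?expr1; ring.
have := det_lagrange_diff b (fun j => - a j) (fun j => - b j) a_inj.
have -> : \matrix_(j, i) ((- b j - b i) * lagrange_mx a (fun j => - a j) j i)
   = - (B *m L + L *m B).
  by apply/matrixP => i j; rewrite mxE mxE mul_mx_diag mul_diag_mx !mxE; ring.
have eqdet : \det (B *m L + L *m B) = \det (G *m (Ev - Od) + (Ev - Od) *m G).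
  have h : (B *m L + L *m B) *m V = V *m (G *m (Ev - Od) + (Ev - Od) *m G).
    move: (Ev - Od) LV => S LV.
    rewrite mulmxDl mulmxDr (mulmxA V G S) VG (mulmxA V S G) -LV.
    by rewrite -!mulmxA VG LV.
  apply: (mulIf (det_vand_neq0 a_inj)).
  by rewrite -det_mulmx h det_mulmx mulrC.
rewrite -scaleN1r detZ eqdet det_parity_mx det_Sign.
have -> : \matrix_(j, i) ((- b j - b i) / (- a j - a i))
          = \matrix_(i, j) ((b i + b j) / (a i + a j)).
  by apply/matrixP => i j; rewrite !mxE -!opprD invrN mulrNN.
(* The n^2 signs reduce to (-1)^n, since n^2 and n have the same parity. *)
have -> : \prod_j \prod_i (- a j - a i)
          = (-1) ^+ n * \prod_i \prod_j (a i + a j).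
  transitivity (\prod_(j < n) ((-1) ^+ n * \prod_i (a j + a i))).
    apply: eq_bigr => j _; rewrite -[n in (-1) ^+ n]card_ord -prodr_const -big_split.
    by apply: eq_bigr => i _ /=; ring.
  rewrite big_split prodr_const card_ord /= -exprM -signr_odd oddM andbb.
  by rewrite signr_odd.
rewrite !det_mulmx -/V; have := det_vand_neq0 a_inj; rewrite -/V.
have := pair_sign_neq0 K n.
set s := pair_sign K n; set D := \det V; set S := (-1) ^+ n; set P := \prod_i _.
set M := \det (\matrix_(i, j) _); set P1 := \det (Ev + _); set P2 := \det (_ + Od).
move=> nzs nzD h.
have nzS : S != 0 by rewrite signr_eq0.
have {h} : S * s * (2%:R ^+ n * P1 * P2) = S * s * (P * M / D ^+ 2).
  transitivity (S * (2%:R ^+ n * s * P1 * P2)); first by ring.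
  by rewrite h; field.
move=> /(mulfI (mulf_neq0 nzS nzs)) h.
have : 2%:R ^+ n * P1 * P2 * D ^+ 2 = P * M by rewrite h; field.
by move=> <-; ring.
Qed.

End ParityFactorization.

(** * Reduction of the partition function *)

Section Reduction.
Variable K : fieldType.
Implicit Types (n e m : nat) (x y a : K).

Definition alt e x : K := x ^+ e - x ^- e.
Definition sym e x : K := x ^+ e + x ^- e.

(* With x = sym 2 u and y = sym 2 v, the product of the four factors
   sigma(a u^{+-1} v^{+-1}) where [t = (a + 1/a)^2]. *)
Definition quad t x y : K := t ^+ 2 - t * (4%:R + x * y) + (x + y) ^+ 2.

Lemma quadE a x y : a != 0 -> x != 0 -> y != 0 ->
  sigma (a * x / y) * sigma (a * y / x) * sigma (a * x * y)
    * sigma (a / (x * y)) = quad (sym 1 a ^+ 2) (sym 2 x) (sym 2 y).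
Proof. by move=> *; rewrite /sigma /quad /sym; field; apply/and3P. Qed.

Lemma sqrN1_neq0 (ii : K) : ii ^+ 2 = -1 -> ii != 0.
Proof.
by apply: contra_eq_neq => ->; rewrite expr0n /= eq_sym oppr_eq0 oner_eq0.
Qed.

Lemma sqrN1_inv (ii : K) : ii ^+ 2 = -1 -> ii^-1 = - ii.
Proof.
move=> ii2; have ii0 := sqrN1_neq0 ii2.
by apply: (mulfI ii0); rewrite mulfV // mulrN -expr2 ii2 opprK.
Qed.

(** Since [sigma (ii * z) = ii * (z + z^-1)] is invariant under inversion of [z], the four terms
    share one numerator up to sign. The denominators multiply to [quad] by [quadE]. *)
Lemma MUU_entryE (ii a x y : K) : ii ^+ 2 = -1 -> a != 0 -> x != 0 -> y != 0 ->
  quad (sym 1 a ^+ 2) (sym 2 x) (sym 2 y) != 0 ->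
  sigma (ii / y) * sigma (ii * x) / sigma (a * x / y)
  - sigma (ii / y) * sigma (ii / x) / sigma (a / (x * y))
  - sigma (ii * y) * sigma (ii * x) / sigma (a * x * y)
  + sigma (ii * y) * sigma (ii / x) / sigma (a * y / x)
  = alt 2 x * alt 2 y * (sigma a * (sym 1 a ^+ 2 + sym 2 x + sym 2 y)
                         / quad (sym 1 a ^+ 2) (sym 2 x) (sym 2 y)).
Proof.
move=> ii2 a0 x0 y0.
have ii0 := sqrN1_neq0 ii2.
have iiV := sqrN1_inv ii2.
have s_mul z : z != 0 -> sigma (ii * z) = ii * (z + z^-1).
  by move=> z0; rewrite /sigma invfM iiV; ring.
have s_div z : z != 0 -> sigma (ii / z) = ii * (z + z^-1).
  by move=> z0; rewrite s_mul ?invr_eq0 // invrK addrC.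
rewrite !s_div // !s_mul // -quadE // !mulf_eq0 !negb_or.
(* The fractions are paired as 1/s1 + 1/s2 and 1/s3 + 1/s4 before being brought to the common
   denominator. *)
have num : - (x + x^-1) * (y + y^-1) *
   ((sigma (a * x / y) + sigma (a * y / x)) * (sigma (a / (x * y)) * sigma (a * x * y))
    - (sigma (a / (x * y)) + sigma (a * x * y)) * (sigma (a * x / y) * sigma (a * y / x)))
   = alt 2 x * alt 2 y * (sigma a * (sym 1 a ^+ 2 + sym 2 x + sym 2 y)).
  by rewrite /sigma /alt /sym; field; apply/and3P.
rewrite [RHS]mulrA -num; move: (sigma _) (sigma _) (sigma _) (sigma _) => s1 s4 s3 s2.
move=> /andP[/andP[/andP[h1 h4] h3] h2].
have -> : - (x + x^-1) * (y + y^-1) = ii ^+ 2 * ((x + x^-1) * (y + y^-1)).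
  by rewrite ii2; ring.
by field; rewrite h1 h2 h3 h4 x0 y0.
Qed.

(** What remains of the partition function once the powers of [sigma a] and the row and column
    factors [alt 2] are removed; it depends on [a] only through t. *)
Definition cauchy_core n (X Y : 'I_n -> K) t : K :=
  (\prod_i \prod_j quad t (X i) (Y j))
  * \det (\matrix_(i, j) ((t + X i + Y j) / quad t (X i) (Y j)))
  / \prod_(i < n) \prod_(j < n | (i < j)%N) ((X i - X j) * (Y i - Y j)).

(** The factors [sym 1 a] of [sigma (ii / a)] and [sigma (a ^+ 2)] cancel, as do the [alt 2] factors
    of the matrix against the diagonal of the denominator of [FV]. *)
Lemma A2UU_core n (x y : 'I_n -> K) (ii a : K) : ii ^+ 2 = -1 ->
  a != 0 -> sigma a != 0 -> sym 1 a != 0 ->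
  (forall i, x i != 0) -> (forall i, y i != 0) ->
  (forall i, alt 2 (x i) != 0) -> (forall i, alt 2 (y i) != 0) ->
  (forall i j, quad (sym 1 a ^+ 2) (sym 2 (x i)) (sym 2 (y j)) != 0) ->
  A2UU x y a ii ii
  = sigma a ^- (2 * (n * n.-1))
    * cauchy_core (fun i => sym 2 (x i)) (fun j => sym 2 (y j)) (sym 1 a ^+ 2).
Proof.
move=> ii2 a0 sa0 sym0 x0 y0 ax0 ay0 q0; rewrite /A2UU /cauchy_core.
have ii0 := sqrN1_neq0 ii2.
have -> : MUU x y a ii ii = \matrix_(i, j) (alt 2 (x i) * alt 2 (y j)
    * ((sigma a *: \matrix_(i, j) ((sym 1 a ^+ 2 + sym 2 (x i) + sym 2 (y j))
                         / quad (sym 1 a ^+ 2) (sym 2 (x i)) (sym 2 (y j)))) i j)).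
  by apply/matrixP => i j; rewrite !mxE MUU_entryE // -!mulrA.
rewrite det_scale_rows_cols detZ.
have -> : FV x y a = (\prod_i \prod_j quad (sym 1 a ^+ 2) (sym 2 (x i)) (sym 2 (y j)))
   / ((\prod_(i < n) \prod_(j < n | (i < j)%N)
         ((sym 2 (x i) - sym 2 (x j)) * (sym 2 (y i) - sym 2 (y j))))
      * ((-1) ^+ n * (\prod_i alt 2 (x i)) * (\prod_i alt 2 (y i)))).
  rewrite /FV; congr (_ / _).
    by apply: eq_bigr => i _; apply: eq_bigr => j _; rewrite quadE.
  (* The diagonal terms are sigma(1/x_i^2) sigma(y_i^2), which give the [alt 2] factors and the sign
     (-1)^n. *)
  have split_diag (F : 'I_n -> 'I_n -> K) :
      \prod_(i < n) \prod_(j < n | (i <= j)%N) F i j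
      = (\prod_(i < n) \prod_(j < n | (i < j)%N) F i j) * \prod_i F i i.
    rewrite -big_split; apply: eq_bigr => i _ /=.
    rewrite (bigD1 i) //= mulrC; congr (_ * _); apply: eq_bigl => j.
    by rewrite ltn_neqAle -val_eqE eq_sym andbC.
  rewrite split_diag mulrA -big_split; congr (_ * _) => /=.
    apply: eq_bigr => i _; rewrite -big_split; apply: eq_bigr => j _ /=.
    rewrite /sigma /sym; have := x0 i; have := x0 j; have := y0 i; have := y0 j.
    by move=> h1 h2 h3 h4; field; rewrite h1 h2 h3 h4 oner_eq0.
  have -> : (-1) ^+ n = \prod_(i < n) (-1 : K) by rewrite prodr_const card_ord.
  rewrite -!big_split; apply: eq_bigr => i _ /=.
  rewrite /sigma /alt; have := x0 i; have := y0 i.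
  by move=> h1 h2; field; rewrite h1 h2 ?oner_eq0.
have -> : sigma (ii / a) = ii * sym 1 a.
  by rewrite /sigma /sym invfM invrK expr1 (sqrN1_inv ii2); ring.
have -> : sigma (a ^+ 2) = sigma a * sym 1 a.
  by rewrite /sigma /sym; field.
(* Of the 3n extra factors [sigma a], 2n cancel with [sigma (a ^+ 2)] and n with the determinant. *)
have -> : (2 * n ^ 2 + n = 2 * (n * n.-1) + 3 * n)%N by case: (n) => //= m; lia.
have px : \prod_i alt 2 (x i) != 0 by apply/prodf_neq0.
have py : \prod_i alt 2 (y i) != 0 by apply/prodf_neq0.
(* The signs are collected as powers of [ii]: one square of [ii ^+ n] comes from [sigma (ii / a)],
   the other is the (-1)^n of [FV]. *)
have I4 : ii ^+ n ^+ 4 = 1.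
  by rewrite -exprM mulnC (exprM _ 4) (exprM _ 2 2) ii2 sqrrN !expr1n.
have <- : ii ^+ n ^+ 2 = (-1) ^+ n by rewrite -exprM mulnC exprM ii2.
have -> : (sigma a * sym 1 a) ^+ (2 * n) = sigma a ^+ n ^+ 2 * sym 1 a ^+ n ^+ 2.
  by rewrite mulnC exprM !exprMn.
rewrite exprMn exprD [(3 * n)%N]mulnC (exprM _ n 3).
have : ii ^+ n != 0 by rewrite expf_neq0.
have : sigma a ^+ n != 0 by rewrite expf_neq0.
have : sym 1 a ^+ n != 0 by rewrite expf_neq0.
have : sigma a ^+ (2 * (n * n.-1)) != 0 by rewrite expf_neq0.
move: (_ ^+ (2 * _)) (sym 1 a ^+ n) (sigma a ^+ n) (ii ^+ n) I4 px py.
move: (\prod_i alt 2 (x i)) (\prod_i alt 2 (y i)) (\det _) => px py d.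
move=> S m s I I4 px0 py0 S0 m0 s0 I0.
rewrite (invfM (\prod_(i < n) _) (I ^+ 2 * px * py)).
move: (\prod_i \prod_j _) (\prod_(i < n) _)^-1 => q r.
transitivity (S^-1 * (q * d * r) * (I ^+ 4)^-1).
  by rewrite invfM; field; rewrite S0 m0 s0 I0 px0 py0.
by rewrite I4 invr1 mulr1.
Qed.

End Reduction.

(** * Alternants *)

Section Alternants.
Variable K : fieldType.
Implicit Types (N e m : nat).

(** The numbers x^m and x^-m are the roots of T^2 - [sym m x] T + 1. *)
Lemma alt_rec m e (x : K) : x != 0 ->
  alt (e + 2 * m) x = sym m x * alt (e + m) x - alt e x.
Proof.
move=> x0; rewrite /alt /sym mul2n -addnn !exprD.
by have := expf_neq0 m x0; have := expf_neq0 e x0; move=> h1 h2; field; rewrite h1 h2.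
Qed.

Variables (N : nat) (w : 'I_N -> K).
Hypothesis w0 : forall i, w i != 0.

(** The recurrence is used in steps of two indices, with [sym 4] = ([sym 2])^2 - 2, which explains
    the constant 2. *)
Lemma alt_lead_vand : forall k, same_lead (fun j i => alt (2 * j + 1) (w i))
   (fun j i => alt 1 (w i) * sym 2 (w i) ^+ j) k.
Proof.
apply: (@same_lead_rec _ _ _ _ (fun i => sym 2 (w i) ^+ 2) 2%:R).
- by move=> k i; rewrite (exprD _ 2 k); ring.
- move=> k i; have -> : (2 * k.+4 + 1 = (2 * k + 1) + 2 * 4)%N by lia.
  rewrite alt_rec //; have -> : (2 * k + 1 + 4 = 2 * k.+2 + 1)%N by lia.
  by congr (_ * _ - _); rewrite /sym; field.
(* With X = [sym 2], the quotients of the alternants 3, 5, 7 by [alt 1] are X + 1, X^2 + X - 1 and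
   X^3 + X^2 - 2 X - 1; the witnesses are their lower coefficients. *)
case=> [|[|[|[|//]]]] _.
- by exists (fun=> 0) => i; rewrite big_ord0 expr0 mulr1 subrr.
- exists (fun=> 1) => i; rewrite !big_ord_recr big_ord0 /alt /sym /=; field; exact: w0.
- exists (nth 0 [:: -1; 1]) => i; rewrite !big_ord_recr big_ord0 /alt /sym /=; field; exact: w0.
exists (nth 0 [:: -1; - 2%:R; 1]) => i.
rewrite !big_ord_recr big_ord0 /alt /sym /=; field; exact: w0.
Qed.


(* exponents 1, 5, 7, 11, 13, ... *)
Lemma alt_lead_mod6 : forall k, same_lead
   (fun j i => alt (6 * j./2 + 4 * odd j + 1) (w i))
   (fun j i => alt 1 (w i) * (sym 6 (w i) ^+ j./2
                    * (sym 2 (w i) ^+ 2 + sym 2 (w i) - 1) ^+ odd j)) k.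
Proof.
apply: (@same_lead_rec _ _ _ _ (fun i => sym 6 (w i)) 0).
- by move=> k i; rewrite /= negbK exprS; ring.
- move=> k i; have -> : (6 * (k.+4)./2 + 4 * odd k.+4 + 1
                       = (6 * k./2 + 4 * odd k + 1) + 2 * 6)%N by lia.
  rewrite alt_rec // subr0; congr (_ * alt _ _ - _); lia.
(* With f = [sym 6] and g as in the statement, exponents 1, 5, 7, 11 divided by [alt 1] give 1, g, f
   + g and f g + 1. *)
case=> [|[|[|[|//]]]] _.
- by exists (fun=> 0) => i; rewrite big_ord0 !expr0 !mulr1 subrr.
- exists (fun=> 0) => i; rewrite !big_ord_recr big_ord0 /alt /sym /=; field; exact: w0.
- exists (nth 0 [:: 0; 1]) => i; rewrite !big_ord_recr big_ord0 /alt /sym /=; field; exact: w0.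
exists (nth 0 [:: 1]) => i; rewrite !big_ord_recr big_ord0 /alt /sym /=; field; exact: w0.
Qed.

(* exponents 1, 7, 9, 15, 17, ... *)
Lemma alt_lead_mod8_1 : forall k, same_lead
   (fun j i => alt (4 * j + 2 * odd j + 1) (w i))
   (fun j i => alt 1 (w i) * (sym 4 (w i) ^+ j * (sym 2 (w i) + 1) ^+ odd j)) k.
Proof.
(* The constant 2 comes from [sym 8] = ([sym 4])^2 - 2. *)
apply: (@same_lead_rec _ _ _ _ (fun i => sym 4 (w i) ^+ 2) 2%:R).
- by move=> k i; rewrite /= negbK (exprD _ 2 k); ring.
- move=> k i; have -> : (4 * k.+4 + 2 * odd k.+4 + 1
                       = (4 * k + 2 * odd k + 1) + 2 * 8)%N by lia.
  rewrite alt_rec //; congr (_ * alt _ _ - _); last lia.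
  by rewrite /sym; field.
case=> [|[|[|[|//]]]] _.
- by exists (fun=> 0) => i; rewrite big_ord0 !expr0 !mulr1 subrr.
- exists (fun=> 1) => i; rewrite !big_ord_recr big_ord0 /alt /sym /=; field; exact: w0.
- exists (nth 0 [:: -1; 1]) => i; rewrite !big_ord_recr big_ord0 /alt /sym /=; field; exact: w0.
exists (nth 0 [:: -1; - 2%:R; 1]) => i.
rewrite !big_ord_recr big_ord0 /alt /sym /=; field; exact: w0.
Qed.

(* exponents 3, 5, 11, 13, 19, ... *)
Lemma alt_lead_mod8_3 : forall k, same_lead
   (fun j i => alt (4 * j + 2 * ~~ odd j + 1) (w i))
   (fun j i => alt 1 (w i) * (sym 4 (w i) ^+ j * (sym 2 (w i) + 1) ^+ ~~ odd j)) k.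
Proof.
apply: (@same_lead_rec _ _ _ _ (fun i => sym 4 (w i) ^+ 2) 2%:R).
- by move=> k i; rewrite /= negbK (exprD _ 2 k); ring.
- move=> k i; have -> : (4 * k.+4 + 2 * ~~ odd k.+4 + 1
                       = (4 * k + 2 * ~~ odd k + 1) + 2 * 8)%N by lia.
  rewrite alt_rec //; congr (_ * alt _ _ - _); last lia.
  by rewrite /sym; field.
case=> [|[|[|[|//]]]] _.
- exists (fun=> 0) => i; rewrite big_ord0 /alt /sym /=; field; exact: w0.
- exists (fun=> 1) => i; rewrite !big_ord_recr big_ord0 /alt /sym /=; field; exact: w0.
- exists (nth 0 [:: -1; 1]) => i; rewrite !big_ord_recr big_ord0 /alt /sym /=; field; exact: w0.
exists (nth 0 [:: -1; - 2%:R; 1]) => i.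
rewrite !big_ord_recr big_ord0 /alt /sym /=; field; exact: w0.
Qed.

Lemma det_alt_factor (F : 'M[K]_N) :
  \det (\matrix_(i, j) (alt 1 (w i) * F i j)) = (\prod_i alt 1 (w i)) * \det F.
Proof.
have -> : \matrix_(i, j) (alt 1 (w i) * F i j)
          = diag_mx (\row_i alt 1 (w i)) *m F.
  by apply/matrixP => i j; rewrite mul_diag_mx !mxE.
rewrite det_mulmx det_diag; congr (_ * _); apply: eq_bigr => i _.
by rewrite mxE.
Qed.

Lemma Oalt_rev la : \matrix_(i, j) Oalt la w i (rev_ord j)
  = \matrix_(i, j) alt (2 * (nth 0%N la (N - j.+1) + j) + 1) (w i).
Proof.
apply/matrixP => i j; rewrite !mxE /= /alt.
by have -> : (N - (N - j.+1).+1 = j)%N by have := ltn_ord j; lia.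
Qed.

(** Numerator and denominator acquire the same sign [d] from the reversal of columns and the same
    product of [alt 1 (w i)]; both cancel in the quotient. *)
Lemma Otilde_lead la (e : nat -> nat) (F : nat -> 'I_N -> K) :
  (forall i, alt 1 (w i) != 0) ->
  injective (fun i => sym 2 (w i)) ->
  (forall j, (j < N)%N -> (2 * (nth 0%N la (N - j.+1) + j) + 1 = e j)%N) ->
  (forall k, same_lead (fun j i => alt (e j) (w i))
                       (fun j i => alt 1 (w i) * F j i) k) ->
  Otilde la w = \det (\matrix_(i, j) F j i) / \det (vand (fun i => sym 2 (w i))).
Proof.
move=> aw inj_w eqe lead.
pose d : K := \det (perm_mx (perm (@rev_ord_inj N))^-1).
have d0 : d != 0 by rewrite /d det_perm signr_eq0.
have detE mu : \det (\matrix_(i, j) alt (2 * (nth 0%N mu (N - j.+1) + j) + 1) (w i))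
               = \det (Oalt mu w) * d.
  rewrite -Oalt_rev -det_mulmx -col_permE; congr (\det _).
  by apply/matrixP => i j; rewrite !mxE permE.
have num : \det (Oalt la w) * d = (\prod_i alt 1 (w i)) * \det (\matrix_(i, j) F j i).
  rewrite -detE -det_alt_factor.
  transitivity (\det (\matrix_(i < N, j < N) alt (e j) (w i))).
    by congr (\det _); apply/matrixP => i j; rewrite !mxE eqe.
  rewrite (det_same_lead lead); congr (\det _).
  by apply/matrixP => i j; rewrite !mxE.
have den : \det (Oalt [::] w) * d
           = (\prod_i alt 1 (w i)) * \det (vand (fun i => sym 2 (w i))).
  rewrite -detE -det_alt_factor.
  transitivity (\det (\matrix_(i < N, j < N) alt (2 * j + 1) (w i))).
    by congr (\det _); apply/matrixP => i j; rewrite !mxE nth_nil.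
  rewrite (det_same_lead alt_lead_vand); congr (\det _).
  by apply/matrixP => i j; rewrite !mxE.
have aw0 : \prod_i alt 1 (w i) != 0 by apply/prodf_neq0.
rewrite /Otilde -[LHS]mulr1 -(divff d0) mulf_div num den -mulf_div.
by rewrite divff // mul1r.
Qed.

End Alternants.

(** * Explicit entries of the merged sequences *)

Lemma sorted_geqP (s t : seq nat) : sorted geq t -> perm_eq s t -> sort geq s = t.
Proof.
move=> sort_t eq_st; apply: (sorted_eq (leT := geq)) => //.
- by move=> m p q /= h1 h2; apply: leq_trans h2 h1.
- by move=> m p; rewrite /geq /= -eqn_leq eq_sym => /eqP.
- by apply: sort_sorted => m p; apply: leq_total.
by rewrite perm_sort.
Qed.

Lemma sorted_mkseq_geq (f : nat -> nat) m :
  (forall j, f j.+1 <= f j)%N -> sorted geq (mkseq f m).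
Proof.
move=> mono; apply/(sortedP 0%N) => i; rewrite size_mkseq => lt_im.
by rewrite (nth_mkseq _ _ lt_im) (nth_mkseq _ _ (ltnW lt_im)); apply: mono.
Qed.

Lemma mkseq_cons (f : nat -> nat) m :
  mkseq f m.+1 = f 0%N :: mkseq (fun j => f j.+1) m.
Proof. by rewrite /mkseq /= -[1%N]addn0 iotaDl -map_comp. Qed.

Lemma deltaS (m : nat) : delta m.+1 = m.+1 :: delta m.
Proof.
rewrite -[LHS]/(mkseq (fun k => m.+1 - k)%N m.+2) mkseq_cons subn0.
by congr (_ :: _); apply: eq_mkseq => k; rewrite subSS.
Qed.

Lemma delta2SS (m : nat) : delta2 m.+2 = m.+2 :: delta2 m.
Proof.
rewrite -[LHS]/(mkseq (fun k => m.+2 - 2 * k)%N (m./2).+2) mkseq_cons subn0.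
by congr (_ :: _); apply: eq_mkseq => k; lia.
Qed.

Lemma perm_cat_cons2 (a b : nat) s t :
  perm_eq ((a :: s) ++ (b :: t)) (a :: b :: s ++ t).
Proof. by rewrite /= perm_cons perm_catC /= perm_cons perm_catC. Qed.

(** The merged list reads n, n-1, n-1, ..., 0, 0. Removing one head from each staircase leaves the
    same pair for the preceding n. *)
Lemma delta_pairE n : delta_pair n%:Z (n%:Z - 1)
  = mkseq (fun j => n - uphalf j)%N (n + n).+1.
Proof.
apply: sorted_geqP; first by apply: sorted_mkseq_geq => j; lia.
elim: n => [|n IHn] //.
have -> : n.+1%:Z - 1 = n%:Z by lia.
have -> : ((n.+1 + n.+1).+1 = (n + n).+3)%N by lia.
have delta_n : delta n%:Z = n :: delta (n%:Z - 1).
  case: (n) => [|m] //; rewrite deltaS; congr (_ :: delta _); lia.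
rewrite 2!mkseq_cons deltaS {2}delta_n.
apply: (perm_trans (perm_cat_cons2 _ _ _ _)); rewrite subn0 subSS subn0.
rewrite 2!perm_cons; apply: (perm_trans IHn).
have /eq_mkseq -> // : (fun j => n - uphalf j)%N =1 (fun j => n.+1 - uphalf j.+2)%N.
by move=> j; lia.
Qed.

Lemma delta2_pairE0 n : delta2_pair n%:Z (n%:Z - 2)
  = mkseq (fun j => n - 2 * uphalf j)%N (n./2 + n./2).+1.
Proof.
apply: sorted_geqP; first by apply: sorted_mkseq_geq => j; lia.
elim/ltn_ind: n => -[|[|n]] IHn //.
have -> : n.+2%:Z - 2 = n%:Z by lia.
have -> : ((n.+2)./2 + (n.+2)./2).+1 = (n./2 + n./2).+3 by rewrite /=; lia.
have delta_n : delta2 n%:Z = n :: delta2 (n%:Z - 2).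
  by case: (n) => [|[|m]] //; rewrite delta2SS; congr (_ :: delta2 _); lia.
rewrite 2!mkseq_cons delta2SS {2}delta_n.
apply: (perm_trans (perm_cat_cons2 _ _ _ _)); rewrite subn0 !subSS subn0.
rewrite 2!perm_cons; apply: (perm_trans (IHn n _)) => //.
have /eq_mkseq -> // :
  (fun j => n - 2 * uphalf j)%N =1 (fun j => n.+2 - 2 * uphalf j.+2)%N.
by move=> j; lia.
Qed.

Lemma delta2_pairE1 n : delta2_pair n%:Z n%:Z
  = mkseq (fun j => n - 2 * j./2)%N (n./2 + n./2).+2.
Proof.
apply: sorted_geqP; first by apply: sorted_mkseq_geq => j; lia.
elim/ltn_ind: n => -[|[|n]] IHn //.
have -> : ((n.+2)./2 + (n.+2)./2).+2 = (n./2 + n./2).+4 by rewrite /=; lia.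
rewrite 2!mkseq_cons delta2SS.
apply: (perm_trans (perm_cat_cons2 _ _ _ _)); rewrite !subn0.
rewrite 2!perm_cons; apply: (perm_trans (IHn n _)) => //.
have /eq_mkseq -> // :
  (fun j => n - 2 * j./2)%N =1 (fun j => n.+2 - 2 * (j.+2)./2)%N.
by move=> j; lia.
Qed.

(** * The three evaluations *)

Section Evaluations.
Variable K : fieldType.
Implicit Types n : nat.

Lemma prod_subr_vand n (X Y : 'I_n -> K) :
  \prod_(i < n) \prod_(j < n | (i < j)%N) ((X i - X j) * (Y i - Y j))
  = \det (vand X) * \det (vand Y).
Proof.
rewrite !det_vand -big_split; apply: eq_bigr => i _ /=.
by rewrite -big_split; apply: eq_bigr => j _ /=; ring.
Qed.

Lemma cauchy_core0 n (X Y : 'I_n -> K) :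
  injective X -> injective Y -> (forall i j, X i + Y j != 0) ->
  cauchy_core X Y 0 = \prod_i \prod_j (X i + Y j).
Proof.
move=> X_inj Y_inj nz; rewrite /cauchy_core prod_subr_vand.
have quad0 i j : quad 0 (X i) (Y j) = (X i + Y j) * (X i + Y j).
  by rewrite /quad; ring.
have -> : \prod_i \prod_j quad 0 (X i) (Y j)
    = (\prod_i \prod_j (X i + Y j)) * (\prod_i \prod_j (X i + Y j)).
  rewrite -big_split; apply: eq_bigr => i _; rewrite -big_split.
  by apply: eq_bigr => j _; rewrite quad0.
have -> : \matrix_(i, j) ((0 + X i + Y j) / quad 0 (X i) (Y j))
          = \matrix_(i, j) (X i + Y j)^-1.
  apply/matrixP => i j; rewrite !mxE quad0 add0r; have := nz i j => h.
  by field.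
rewrite -[X in X / _]mulrA [X in _ * X / _]mulrC det_cauchy // mulfK //.
by rewrite mulf_neq0 // det_vand_neq0.
Qed.

(** [det_block_vand] is applied to (f, g) in the numerator and to (X^2, X) in the denominator; the
    interleaving factor [e] and [pair_sign] are common to both and cancel. *)
Lemma cauchy_core1 n (X : 'I_(n + n) -> K) :
  injective (fun k => X k ^+ 2) -> injective (fun k => X k ^+ 3 - 3%:R * X k) ->
  cauchy_core (fun i => X (lshift n i)) (fun j => X (rshift n j)) 1
  = \det (interleaved_vand (fun k => X k ^+ 3 - 3%:R * X k)
                           (fun k => X k ^+ 2 + X k - 1))
    / \det (vand X).
Proof.
move=> sq_inj f_inj; pose x i := X (lshift n i); pose y j := X (rshift n j).
have X_inj : injective X by move=> i j e; apply: sq_inj; rewrite e.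
have ne_lr i j : (rshift n j == lshift n i) = false by rewrite eq_rlshift.
have ne_X i j : y j - x i != 0 by rewrite subr_eq0 (inj_eq X_inj) ne_lr.
have ne_f i j : (y j ^+ 3 - 3%:R * y j) - (x i ^+ 3 - 3%:R * x i) != 0.
  by rewrite subr_eq0 (inj_eq f_inj) ne_lr.
have ne_sq i j : y j ^+ 2 - x i ^+ 2 != 0.
  by rewrite subr_eq0 (inj_eq sq_inj) ne_lr.
have ne_D i j : x i + y j != 0.
  by apply: contraNneq (ne_sq i j) => e; rewrite subr_sqr (addrC (y j) (x i)) e mulr0.
have quad1 i j : quad 1 (x i) (y j) * (y j - x i)
               = (y j ^+ 3 - 3%:R * y j) - (x i ^+ 3 - 3%:R * x i).
  by rewrite /quad; ring.
have x_inj : injective x by move=> i j /X_inj /lshift_inj.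
have y_inj : injective y by move=> i j /X_inj /rshift_inj.
have [e e0 he] := det_interleaved_vand K n.
have -> : \det (vand X) = \det (interleaved_vand (fun k => X k ^+ 2) X).
  congr (\det _); apply/matrixP => i j; rewrite !mxE -exprM -exprD.
  by congr (_ ^+ _); rewrite mul2n addnC odd_double_half.
(* As (y - x)/(y^2 - x^2) = 1/(x + y), this second determinant is a Cauchy determinant. *)
have cancel : \prod_j \prod_i (y j ^+ 2 - x i ^+ 2)
     * \det (\matrix_(j, i) ((y j - x i) / (y j ^+ 2 - x i ^+ 2)))
   = (\prod_j \prod_i (y j - x i)) * (\det (vand x) * \det (vand y)).
  rewrite -det_cauchy // mulrC mulrCA; congr (_ * _).
    rewrite -det_tr; congr (\det _); apply/matrixP => i j; rewrite !mxE.
    rewrite subr_sqr; have := ne_X i j; have := ne_D i j.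
    by rewrite addrC => h1 h2; field; rewrite h1 h2.
  rewrite [X in _ * X]exchange_big -big_split; apply: eq_bigr => j _.
  by rewrite -big_split; apply: eq_bigr => i _ /=; ring.
have core : cauchy_core x y 1 = (\prod_j \prod_i quad 1 (x i) (y j))
    * \det (\matrix_(j, i) (((y j ^+ 2 + y j - 1) - (x i ^+ 2 + x i - 1))
        / ((y j ^+ 3 - 3%:R * y j) - (x i ^+ 3 - 3%:R * x i))))
    / (\det (vand x) * \det (vand y)).
  rewrite /cauchy_core prod_subr_vand exchange_big -det_tr; congr (_ * \det _ / _).
  apply/matrixP => j i; rewrite !mxE -quad1.
  have := ne_f i j; rewrite -quad1 mulf_eq0 negb_or => /andP[h1 h2].
  by field; rewrite h1 h2.
rewrite [LHS]core !he.
rewrite !det_block_vand //; try by move=> i j; rewrite -subr_eq0 ?(ne_sq, ne_f).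
- rewrite -[_ * _ * \det (\matrix_(j, i) ((X (rshift n j) - _) / _))]mulrA.
  rewrite [X in _ / (_ * (_ * X))]cancel.
  have -> : \prod_j \prod_i (y j ^+ 3 - 3%:R * y j - (x i ^+ 3 - 3%:R * x i))
    = (\prod_j \prod_i quad 1 (x i) (y j)) * \prod_j \prod_i (y j - x i).
    rewrite -big_split; apply: eq_bigr => j _; rewrite -big_split.
    by apply: eq_bigr => i _ /=; rewrite quad1.
  have s0 := pair_sign_neq0 K n.
  have P0 : \prod_j \prod_i (y j - x i) != 0.
    by apply/prodf_neq0 => j _; apply/prodf_neq0 => i _.
  have := det_vand_neq0 x_inj; have := det_vand_neq0 y_inj => h1 h2.
  by field; rewrite s0 P0 h1 h2 e0.
- by move=> i j /sq_inj /lshift_inj.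
by move=> i j /f_inj /lshift_inj.
Qed.

Lemma cauchy_core2 n (X : 'I_n -> K) :
  injective (fun i => X i ^+ 2 - 2%:R) ->
  (forall i j, (X i ^+ 2 - 2%:R) + (X j ^+ 2 - 2%:R) != 0) ->
  cauchy_core X X 2%:R
  = 2%:R ^+ n
    * \det (\matrix_(i < n, k < n) ((X i ^+ 2 - 2%:R) ^+ k * (X i + 1) ^+ odd k))
    * \det (\matrix_(i < n, k < n) ((X i ^+ 2 - 2%:R) ^+ k * (X i + 1) ^+ ~~ odd k))
    / \det (vand X) ^+ 2.
Proof.
move=> a_inj nz; rewrite /cauchy_core prod_subr_vand -expr2.
rewrite -(det_parity_factor (fun i => X i + 1) a_inj nz).
have quad2 i j : quad 2%:R (X i) (X j) = (X i ^+ 2 - 2%:R) + (X j ^+ 2 - 2%:R).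
  by rewrite /quad; ring.
congr (_ * _ / _).
  by apply: eq_bigr => i _; apply: eq_bigr => j _; rewrite quad2.
congr (\det _); apply/matrixP => i j; rewrite !mxE quad2; congr (_ / _); ring.
Qed.

Lemma Otilde_delta n (w : 'I_(n + n) -> K) : (forall i, w i != 0) ->
  (forall i, alt 1 (w i) != 0) -> injective (fun i => sym 2 (w i)) ->
  Otilde (delta_pair n%:Z (n%:Z - 1)) w
  = \det (interleaved_vand (fun k => sym 6 (w k))
                           (fun k => sym 2 (w k) ^+ 2 + sym 2 (w k) - 1))
    / \det (vand (fun k => sym 2 (w k))).
Proof.
move=> w0 aw w_inj; rewrite (Otilde_lead w0 aw w_inj _ (alt_lead_mod6 w0)) //.
by move=> j lt_j; rewrite delta_pairE nth_mkseq; lia.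
Qed.

Lemma Otilde_delta2 n (w : 'I_n.+1 -> K) : (forall i, w i != 0) ->
  (forall i, alt 1 (w i) != 0) -> injective (fun i => sym 2 (w i)) ->
  Otilde (delta2_pair n.+1%:Z (n.+1%:Z - 2)) w
  * Otilde (delta2_pair (n.+1%:Z - 1) (n.+1%:Z - 1)) w
  = \det (\matrix_(i < n.+1, k < n.+1) (sym 4 (w i) ^+ k * (sym 2 (w i) + 1) ^+ odd k))
    * \det (\matrix_(i < n.+1, k < n.+1) (sym 4 (w i) ^+ k * (sym 2 (w i) + 1) ^+ ~~ odd k))
    / \det (vand (fun i => sym 2 (w i))) ^+ 2.
Proof.
move=> w0 aw w_inj; have -> : n.+1%:Z - 1 = n%:Z by lia.
(* The parity decides which character has last used part 0, hence smallest exponent 1, and which has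
   last used part 1, hence smallest exponent 3. *)
have [odd_n | even_n] := boolP (odd n).
  rewrite (Otilde_lead w0 aw w_inj _ (alt_lead_mod8_1 w0)); last first.
    by move=> j lt_j; rewrite delta2_pairE0 nth_mkseq; lia.
  rewrite (Otilde_lead w0 aw w_inj _ (alt_lead_mod8_3 w0)); last first.
    by move=> j lt_j; rewrite delta2_pairE1 nth_mkseq; lia.
  by rewrite mulf_div -expr2.
rewrite (Otilde_lead w0 aw w_inj _ (alt_lead_mod8_3 w0)); last first.
  by move=> j lt_j; rewrite delta2_pairE0 nth_mkseq; lia.
rewrite (Otilde_lead w0 aw w_inj _ (alt_lead_mod8_1 w0)); last first.
  by move=> j lt_j; rewrite delta2_pairE1 nth_mkseq; lia.
by rewrite mulf_div -expr2 mulrC [in RHS]mulrC [X in _ = _ * X]mulrC.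
Qed.

End Evaluations.

(** * Values of rational functions at a point *)

Section HasValue.
Variables (K : fieldType) (a : K).
Implicit Types (f g : {fraction {poly K}}) (u v : K).

Lemma tofrac_horner_neq0 (q : {poly K}) : q.[a] != 0 -> tofrac q != 0.
Proof. by move=> hq; rewrite tofrac_eq0; apply: contra_neq hq => ->; rewrite horner0. Qed.

Lemma has_value_ratcst u : has_value_at (ratcst u) a u.
Proof.
exists u%:P, 1; rewrite !hornerE oner_eq0 tofrac1 !divr1; split => //.
Qed.

Lemma has_value_ratX : has_value_at (ratX K) a a.
Proof.
by exists 'X, 1; rewrite !hornerE oner_eq0 tofrac1 !divr1.
Qed.

Lemma has_value_add f g u v : has_value_at f a u -> has_value_at g a v ->
  has_value_at (f + g) a (u + v).
Proof.
move=> [p1 [q1 [h1 -> ->]]] [p2 [q2 [h2 -> ->]]].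
exists (p1 * q2 + p2 * q1), (q1 * q2); rewrite hornerD !hornerM; split.
- by rewrite mulf_neq0.
- by rewrite tofracD !tofracM addf_div ?tofrac_horner_neq0.
by rewrite addf_div.
Qed.

Lemma has_value_mul f g u v : has_value_at f a u -> has_value_at g a v ->
  has_value_at (f * g) a (u * v).
Proof.
move=> [p1 [q1 [h1 -> ->]]] [p2 [q2 [h2 -> ->]]].
exists (p1 * p2), (q1 * q2); rewrite !hornerM; split.
- by rewrite mulf_neq0.
- by rewrite !tofracM mulf_div.
by rewrite mulf_div.
Qed.

Lemma has_value_inv f u : u != 0 -> has_value_at f a u ->
  has_value_at f^-1 a u^-1.
Proof.
move=> u0 [p [q [h -> eu]]]; exists q, p; split.
- by apply: contra_neq u0 => hp; rewrite eu hp mul0r.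
- by rewrite invf_div.
by rewrite eu invf_div.
Qed.

(** Lets the nonvanishing of a rational function be checked at a single point. *)
Lemma has_value_neq0 f u : u != 0 -> has_value_at f a u -> f != 0.
Proof.
move=> u0 [p [q [h -> eu]]].
have hp : p.[a] != 0 by apply: contra_neq u0 => hp; rewrite eu hp mul0r.
by rewrite mulf_neq0 ?invr_eq0 ?tofrac_horner_neq0.
Qed.

Lemma has_value_opp f u : has_value_at f a u -> has_value_at (- f) a (- u).
Proof.
move=> [p [q [h -> ->]]]; exists (- p), q; rewrite !hornerE tofracN.
by rewrite !mulNr.
Qed.

Lemma has_value_sub f g u v : has_value_at f a u -> has_value_at g a v ->
  has_value_at (f - g) a (u - v).
Proof. by move=> hf hg; apply: has_value_add => //; apply: has_value_opp. Qed.

Lemma has_value1 : has_value_at 1 a 1.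
Proof. by have := has_value_ratcst 1; rewrite /ratcst tofrac1. Qed.

Lemma has_value_exp f u e : has_value_at f a u -> has_value_at (f ^+ e) a (u ^+ e).
Proof.
move=> h; elim: e => [|e IHe]; first exact: has_value1.
by rewrite !exprS; apply: has_value_mul.
Qed.

Lemma has_value_nat m : has_value_at m%:R a m%:R.
Proof. by have := has_value_ratcst m%:R; rewrite /ratcst polyC_natr rmorph_nat. Qed.

Lemma has_value_prod (I : Type) (r : seq I) (P : pred I) F V :
  (forall i, has_value_at (F i) a (V i)) ->
  has_value_at (\prod_(i <- r | P i) F i) a (\prod_(i <- r | P i) V i).
Proof.
move=> h; elim/big_rec2: _ => [|i u f _ hf]; first exact: has_value1.
exact: has_value_mul.
Qed.

Lemma has_value_det n (F : 'M_n) (V : 'M[K]_n) :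
  (forall i j, has_value_at (F i j) a (V i j)) ->
  has_value_at (\det F) a (\det V).
Proof.
move=> h; rewrite /determinant; elim/big_rec2: _ => [|s u f _ hf].
  exact: (has_value_nat 0).
apply: has_value_add => //; apply: has_value_mul; last exact: has_value_prod.
by apply/has_value_exp/has_value_opp/has_value1.
Qed.

Lemma has_value_sym e f u : u != 0 -> has_value_at f a u ->
  has_value_at (sym e f) a (sym e u).
Proof.
move=> u0 h; apply: has_value_add; last apply: has_value_inv.
- exact: has_value_exp.
- by rewrite expf_neq0.
exact: has_value_exp.
Qed.

Lemma has_value_alt e f u : u != 0 -> has_value_at f a u ->
  has_value_at (alt e f) a (alt e u).
Proof.
move=> u0 h; apply: has_value_sub; last apply: has_value_inv.
- exact: has_value_exp.
- by rewrite expf_neq0.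
exact: has_value_exp.
Qed.

Lemma has_value_quad t x y t0 x0 y0 : has_value_at t a t0 ->
  has_value_at x a x0 -> has_value_at y a y0 ->
  has_value_at (quad t x y) a (quad t0 x0 y0).
Proof.
move=> ht hx hy; apply: has_value_add; last exact/has_value_exp/has_value_add.
apply: has_value_sub; first exact: has_value_exp.
apply: has_value_mul => //; apply: has_value_add; last exact: has_value_mul.
exact: has_value_nat.
Qed.

Lemma has_value_cauchy_core n (X Y : 'I_n -> {fraction {poly K}}) (X0 Y0 : 'I_n -> K) t t0 :
  has_value_at t a t0 ->
  (forall i, has_value_at (X i) a (X0 i)) ->
  (forall i, has_value_at (Y i) a (Y0 i)) ->
  injective X0 -> injective Y0 ->
  (forall i j, quad t0 (X0 i) (Y0 j) != 0) ->
  has_value_at (cauchy_core X Y t) a (cauchy_core X0 Y0 t0).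
Proof.
move=> ht hX hY X_inj Y_inj q0; apply: has_value_mul; first apply: has_value_mul.
- apply: has_value_prod => i; apply: has_value_prod => j.
  exact: has_value_quad.
- apply: has_value_det => i j; rewrite !mxE; apply: has_value_mul.
    by apply: has_value_add => //; apply: has_value_add.
  by apply: has_value_inv => //; apply: has_value_quad.
apply: has_value_inv.
  by rewrite prod_subr_vand mulf_neq0 // det_vand_neq0.
apply: has_value_prod => i; apply: has_value_prod => j.
by apply: has_value_mul; apply: has_value_sub.
Qed.

End HasValue.

(* The exponent 24 is a common multiple of all those needed below. *)
Definition generic_point (K : fieldType) N (w : 'I_N -> K) :=
  [/\ forall i, w i != 0,
      forall i j, i != j -> w i ^+ 24 != w j ^+ 24
    & forall i j, (w i * w j) ^+ 24 != 1].

(** * Nonvanishing at generic points *)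

Section GenericPoint.
Variables (K : fieldType) (N : nat) (w : 'I_N -> K).
Hypothesis gen_w : generic_point w.

Lemma generic_neq0 i : w i != 0. Proof. by case: gen_w. Qed.

Lemma generic_expM_neq1 m i j : (m %| 24)%N -> w i ^+ m * w j ^+ m != 1.
Proof.
case: gen_w => _ _ h /dvdnP[q e]; apply: contraNneq (h i j) => eq1.
by rewrite e mulnC exprM exprMn eq1 expr1n.
Qed.

(** Equal values force w_i^m to be w_j^m or its inverse; raised to the power 24/m, either
    contradicts genericity. *)
Lemma sym_generic_inj m : (m %| 24)%N -> injective (fun i => sym m (w i)).
Proof.
move=> dv i j eq_ij; apply/eqP; apply: contraT => ne_ij.
have [w0 h _] := gen_w; have := h i j ne_ij; have /dvdnP[q e] := dv.
apply: contraNT => _; have hi := expf_neq0 m (w0 i); have hj := expf_neq0 m (w0 j).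
have : (w i ^+ m - w j ^+ m) * (w i ^+ m * w j ^+ m - 1)
       = (w i ^+ m * w j ^+ m) * (sym m (w i) - sym m (w j)).
  by rewrite /sym; field; rewrite hi hj.
rewrite eq_ij subrr mulr0 => /eqP; rewrite mulf_eq0 !subr_eq0.
rewrite (negPf (generic_expM_neq1 i j dv)) orbF => /eqP eqm.
by rewrite e mulnC !exprM eqm.
Qed.

(** A zero sum means w_i^m = -w_j^m or (w_i w_j)^m = -1. Squaring removes the sign, hence the
    condition on 2m. *)
Lemma sym_generic_add_neq0 m i j : (m.*2 %| 24)%N -> 2%:R != 0 :> K ->
  sym m (w i) + sym m (w j) != 0.
Proof.
move=> dv two0; have [w0 h h1] := gen_w; have /dvdnP[q e] := dv.
have hi := expf_neq0 m (w0 i); have hj := expf_neq0 m (w0 j).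
have -> : sym m (w i) + sym m (w j)
  = (w i ^+ m + w j ^+ m) * (w i ^+ m * w j ^+ m + 1) / (w i ^+ m * w j ^+ m).
  by rewrite /sym; field; rewrite hi hj.
rewrite !mulf_neq0 ?invr_eq0 ?mulf_neq0 //.
  have [<-|ne_ij] := eqVneq i j; first by rewrite -mulr2n -mulr_natl mulf_neq0.
  apply: contraNneq (h i j ne_ij) => /eqP; rewrite addr_eq0 => /eqP eqm.
  by rewrite e mulnC -muln2 -mulnA !exprM eqm sqrrN.
apply: contraNneq (h1 i j) => /eqP; rewrite addr_eq0 => /eqP eqm.
by rewrite e mulnC -muln2 -mulnA !exprM (exprMn m) eqm sqrrN !expr1n.
Qed.

Lemma alt_generic_neq0 m i : (m %| 24)%N -> alt m (w i) != 0.
Proof.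
move=> dv; have h := expf_neq0 m (generic_neq0 i).
have -> : alt m (w i) = (w i ^+ m * w i ^+ m - 1) / w i ^+ m.
  by rewrite /alt; field.
by rewrite mulf_neq0 ?invr_eq0 // subr_eq0 generic_expM_neq1.
Qed.

End GenericPoint.

(** * Specializations t = 0, 1, 2 *)

Section Specializations.
Variable K : fieldType.

Lemma sym2_sqr (x : K) : x != 0 -> sym 2 x ^+ 2 - 2%:R = sym 4 x.
Proof. by move=> x0; rewrite /sym; field. Qed.

Lemma sym2_cube (x : K) : x != 0 -> sym 2 x ^+ 3 - 3%:R * sym 2 x = sym 6 x.
Proof. by move=> x0; rewrite /sym; field. Qed.

Lemma sigma_sqr (a : K) : a != 0 -> sigma a ^+ 2 = sym 1 a ^+ 2 - 4%:R.
Proof. by move=> a0; rewrite /sigma /sym; field. Qed.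

(** The sign disappears because n (n - 1) is even. *)
Lemma sqr_oppr_expV n (s c : K) : s ^+ 2 = - c ->
  s ^- (2 * (n * n.-1)) = c ^- (n * n.-1).
Proof.
move=> eqc; rewrite exprM eqc exprNn -signr_odd oddM.
by case: n => [|n]; rewrite /= ?andNb ?mul1r //; case: odd; rewrite mul1r.
Qed.

(** [A2UU_core] is applied with [a] an indeterminate, where [sym 1 a] is invertible and cancels; the
    remaining core is regular at [ii], where t = 0. *)
Lemma has_value_A2UU n (w : 'I_(n + n) -> K) (ii : K) :
  generic_point w -> 2%:R != 0 :> K -> ii ^+ 2 = -1 ->
  has_value_at
    (A2UU (fun i => ratcst (w (lshift n i))) (fun j => ratcst (w (rshift n j)))
          (ratX K) (ratcst ii) (ratcst ii)) ii
    (4%:R ^- (n * n.-1)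
     * \prod_i \prod_j (sym 2 (w (lshift n i)) + sym 2 (w (rshift n j)))).
Proof.
move=> gen_w two0 ii2; have w0 := generic_neq0 gen_w.
have ii0 := sqrN1_neq0 ii2.
have sym_ii : sym 1 ii = 0.
  by apply: (mulfI ii0); rewrite /sym mulr0 mulrDr expr1 mulfV // -expr2 ii2 addNr.
have sigma_ii : sigma ii ^+ 2 = - 4%:R by rewrite sigma_sqr // sym_ii; ring.
have four0 : 4%:R != 0 :> K by rewrite (natrM _ 2 2) mulf_neq0.
have sigma_ii0 : sigma ii != 0.
  by rewrite -sqrf_eq0 sigma_ii oppr_eq0.
have hX := has_value_ratX ii.
have hw k : has_value_at (ratcst (w k)) ii (w k) by apply: has_value_ratcst.
have hsym k : has_value_at (sym 2 (ratcst (w k))) ii (sym 2 (w k)).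
  exact: has_value_sym.
have halt k : alt 2 (ratcst (w k)) != 0.
  apply: (has_value_neq0 (alt_generic_neq0 gen_w k (m := 2) isT)).
  exact: has_value_alt (hw k).
have hsig : has_value_at (sigma (ratX K)) ii (sigma ii).
  by apply: has_value_sub => //; apply: has_value_inv.
have ht : has_value_at (sym 1 (ratX K) ^+ 2) ii 0.
  have -> : 0 = sym 1 ii ^+ 2 by rewrite sym_ii expr0n.
  by apply/has_value_exp/has_value_sym.
have sum0 i j : sym 2 (w i) + sym 2 (w j) != 0.
  exact: sym_generic_add_neq0.
have quad0 i j : quad 0 (sym 2 (w i)) (sym 2 (w j)) != 0.
  have -> : quad 0 (sym 2 (w i)) (sym 2 (w j)) = (sym 2 (w i) + sym 2 (w j)) ^+ 2.
    by rewrite /quad; ring.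
  by rewrite expf_neq0.
have inj2 := sym_generic_inj gen_w (m := 2) isT.
rewrite (A2UU_core (a := ratX K)).
- rewrite -(sqr_oppr_expV n sigma_ii) -cauchy_core0 //; last first.
  + by move=> i j /inj2 /rshift_inj.
  + by move=> i j /inj2 /lshift_inj.
  apply: has_value_mul.
    by apply: has_value_inv; [rewrite expf_neq0 | apply: has_value_exp].
  apply: has_value_cauchy_core => //.
  + by move=> i j /inj2 /lshift_inj.
  + by move=> i j /inj2 /rshift_inj.
- have -> : -1 = ratcst (-1 : K) by rewrite /ratcst polyCN tofracN tofrac1.
  by rewrite -ii2 /ratcst polyCM tofracM.
- exact: has_value_neq0 hX.
- exact: has_value_neq0 hsig.
(* At [ii] the value would be 0, so nonvanishing is checked at 1, where the value is 2. *)
- have h1 := has_value_sym 1 (oner_neq0 K) (has_value_ratX 1).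
  by apply: (has_value_neq0 _ h1); rewrite /sym expr1 invr1.
- by move=> i; apply: (has_value_neq0 (w0 _)).
- by move=> i; apply: (has_value_neq0 (w0 _)).
- by move=> i; apply: halt.
- by move=> i; apply: halt.
move=> i j; apply: (has_value_neq0 (quad0 (lshift n i) (rshift n j))).
exact: has_value_quad ht (hsym _) (hsym _).
Qed.

Lemma A2UU_sym1_sqr1 n (w : 'I_(n + n) -> K) (ii a : K) :
  generic_point w -> 3%:R != 0 :> K -> ii ^+ 2 = -1 -> a != 0 -> sym 1 a ^+ 2 = 1 ->
  A2UU (fun i => w (lshift n i)) (fun j => w (rshift n j)) a ii ii
  = 3%:R ^- (n * n.-1) * Otilde (delta_pair n%:Z (n%:Z - 1)) w.
Proof.
move=> gen_w three0 ii2 a0 sym_a; have w0 := generic_neq0 gen_w.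
have sigma_a : sigma a ^+ 2 = - 3%:R by rewrite sigma_sqr // sym_a; ring.
have inj2 := sym_generic_inj gen_w (m := 2) isT.
have inj6 := sym_generic_inj gen_w (m := 6) isT.
rewrite A2UU_core //.
- rewrite (sqr_oppr_expV n sigma_a) sym_a Otilde_delta //; last first.
    by move=> i; apply: (alt_generic_neq0 gen_w).
  rewrite (cauchy_core1 (X := fun k => sym 2 (w k))).
  + congr (_ * (\det _ / _)); apply/matrixP => i j.
    by rewrite !mxE sym2_cube.
  + move=> i j /= e; apply: (sym_generic_inj gen_w (m := 4) isT) => /=.
    by rewrite -!sym2_sqr // e.
  by move=> i j /=; rewrite !sym2_cube //; apply: inj6.
- by rewrite -sqrf_eq0 sigma_a oppr_eq0.
- by rewrite -sqrf_eq0 sym_a oner_eq0.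
- by move=> i; apply: (alt_generic_neq0 gen_w).
- by move=> i; apply: (alt_generic_neq0 gen_w).
move=> i j; rewrite sym_a.
(* [quad] divides f(Y) - f(X), which genericity keeps away from 0. *)
have : quad 1 (sym 2 (w (lshift n i))) (sym 2 (w (rshift n j)))
       * (sym 2 (w (rshift n j)) - sym 2 (w (lshift n i)))
     = sym 6 (w (rshift n j)) - sym 6 (w (lshift n i)).
  by rewrite -!sym2_cube // /quad; ring.
move=> e; have : sym 6 (w (rshift n j)) - sym 6 (w (lshift n i)) != 0.
  by rewrite subr_eq0 (inj_eq inj6) eq_rlshift.
by rewrite -e mulf_eq0 negb_or => /andP[].
Qed.

Lemma A2UU_sym1_sqr2 n (w : 'I_n -> K) (ii a : K) : (0 < n)%N ->
  generic_point w -> 2%:R != 0 :> K -> ii ^+ 2 = -1 -> a != 0 ->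
  sym 1 a ^+ 2 = 2%:R ->
  A2UU w w a ii ii
  = 2%:R ^- (n * n.-1) * 2%:R ^+ n
    * Otilde (delta2_pair n%:Z (n%:Z - 2)) w
    * Otilde (delta2_pair (n%:Z - 1) (n%:Z - 1)) w.
Proof.
case: n w => // n w _ gen_w two0 ii2 a0 sym_a; have w0 := generic_neq0 gen_w.
have sigma_a : sigma a ^+ 2 = - 2%:R by rewrite sigma_sqr // sym_a; ring.
have inj2 := sym_generic_inj gen_w (m := 2) isT.
have inj4 := sym_generic_inj gen_w (m := 4) isT.
have sum4 i j : sym 4 (w i) + sym 4 (w j) != 0 by apply: sym_generic_add_neq0.
rewrite A2UU_core //.
- rewrite (sqr_oppr_expV n.+1 sigma_a) sym_a -(mulrA _ (Otilde _ w) (Otilde _ w)).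
  rewrite Otilde_delta2 //; last first.
    by move=> i; apply: (alt_generic_neq0 gen_w).
  rewrite (cauchy_core2 (X := fun k => sym 2 (w k))).
  + rewrite -!mulrA; congr (_ * (_ * (_ * (_ * _)))); congr (\det _);
    by apply/matrixP => i j; rewrite !mxE sym2_sqr.
  + by move=> i j /=; rewrite !sym2_sqr //; apply: inj4.
  by move=> i j /=; rewrite !sym2_sqr.
- by rewrite -sqrf_eq0 sigma_a oppr_eq0.
- by rewrite -sqrf_eq0 sym_a.
- by move=> i; apply: (alt_generic_neq0 gen_w).
- by move=> i; apply: (alt_generic_neq0 gen_w).
move=> i j; rewrite sym_a.
have -> : quad 2%:R (sym 2 (w i)) (sym 2 (w j)) = sym 4 (w i) + sym 4 (w j).
  by rewrite -!sym2_sqr // /quad; ring.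
exact: sum4.
Qed.

End Specializations.

(** * Powers of the roots of unity *)

Section RootsOfUnity.
Variable R : realType.

Lemma expr_cos_sin (t : R) k :
  Complex (trigo.cos t) (trigo.sin t) ^+ k
  = Complex (trigo.cos (t *+ k)) (trigo.sin (t *+ k)).
Proof.
elim: k => [|k IHk]; first by rewrite !mulr0n trigo.cos0 trigo.sin0.
rewrite exprS IHk mulrS trigo.cosD trigo.sinD; apply/eqP; rewrite eq_complex /=.
by rewrite eqxx /= addrC.
Qed.

Lemma zeta_exp k m : (0 < k)%N -> zeta R (k * m) ^+ k = zeta R m.
Proof.
move=> k_gt0; rewrite /zeta expr_cos_sin.
have -> // : 2%:R * trigo.pi / (k * m)%:R *+ k = 2%:R * trigo.pi / m%:R :> R.
rewrite -mulr_natr natrM invfM; have k0 : k%:R != 0 :> R by rewrite pnatr_eq0 -lt0n.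
by rewrite -mulrA; congr (_ * _); rewrite mulrAC mulVf // mul1r.
Qed.

Lemma zeta2 : zeta R 2 = -1.
Proof.
rewrite /zeta mulrAC divff ?pnatr_eq0 // mul1r trigo.cospi trigo.sinpi.
by apply/eqP; rewrite eq_complex /= oppr0 !eqxx.
Qed.

(** Divide z^3 + 1 = 0 by z + 1, which is nonzero since z has positive imaginary part sin(pi/3). *)
Lemma zeta6_sqr : zeta R 6 ^+ 2 = zeta R 6 - 1.
Proof.
have z3 : zeta R 6 ^+ 3 = -1 by rewrite (zeta_exp (k := 3) 2) // zeta2.
have nz : zeta R 6 + 1 != 0.
  rewrite eq_complex /= negb_and addr0; apply/orP; right.
  rewrite gt_eqF // trigo.sin_gt0_pi //.
  have pi0 := trigo.pi_gt0 R; apply/andP; split; first by rewrite divr_gt0 // mulr_gt0.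
  by rewrite ltr_pdivrMr // mulrC ltr_pM2l // ltr_nat.
apply: (mulfI nz); have : zeta R 6 ^+ 3 + 1 = 0 by rewrite z3 addNr.
move=> h; apply/eqP; rewrite -subr_eq0 -[X in _ == X]h; apply/eqP; ring.
Qed.

End RootsOfUnity.

(** * Genericity of the indeterminates *)

Section Indeterminates.
Variables (R : realType) (n : nat).

Definition indet (k : 'I_(n + n)) : ratfun R n := tofrac ('X_k : {mpoly R[i][n + n]}).

Lemma generic_indet : generic_point indet.
Proof.
(* Evaluation at the unit vector of index [l] separates the powers of distinct indeterminates;
   products are later separated from 1 by evaluation at the origin. *)
have evalX (k l : 'I_(n + n)) m : (0 < m)%N ->
    (('X_k : {mpoly R[i][n + n]}) ^+ m).@[fun t => (t == l)%:R] = (k == l)%:R.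
  by move=> m_gt0; rewrite rmorphXn /= mevalXU; case: eqP => _;
     rewrite ?expr1n ?expr0n // gtn_eqF.
split.
- move=> k; rewrite tofrac_eq0; apply/eqP => /(congr1 (meval (fun t => (t == k)%:R))).
  by rewrite mevalXU eqxx meval0 => /eqP; rewrite oner_eq0.
- move=> k l; move: {1 2}24%N (isT : (0 < 24)%N) => m m_gt0 ne_kl.
  rewrite -!tofracXn tofrac_eq; apply/eqP => e.
  have := congr1 (meval (fun t => (t == k)%:R)) e.
  by rewrite !evalX // eqxx eq_sym (negPf ne_kl) => /eqP; rewrite oner_eq0.
move=> k l; move: 24%N (isT : (0 < 24)%N) => m m_gt0.
rewrite -tofracM -tofracXn -tofrac1 tofrac_eq; apply/eqP => e.
have := congr1 (meval (fun=> 0)) e; rewrite meval1 rmorphXn rmorphM /= !mevalXU.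
by rewrite mul0r expr0n gtn_eqF // => /eqP; rewrite eq_sym oner_eq0.
Qed.

Lemma cst_nat m : cst n (m%:R : R[i]) = m%:R.
Proof. by rewrite /cst !rmorph_nat. Qed.

Lemma ratfun_nat_neq0 m : m%:R != 0 :> ratfun R n = (m != 0)%N.
Proof. by rewrite -cst_nat /cst tofrac_eq0 mpolyC_eq0 pnatr_eq0. Qed.

End Indeterminates.

(** * Scalar factors and assembly of the identities *)

Lemma prod_sym2_add (K : fieldType) n (x y : 'I_n -> K) :
  (forall i, x i != 0) -> (forall i, y i != 0) ->
  \prod_i \prod_j (sym 2 (x i) + sym 2 (y j))
  = (\prod_(i < n) (x i ^- (2 * n) * y i ^- (2 * n)))
    * (\prod_(i < n) \prod_(j < n)
         ((x i ^+ 2 + y j ^+ 2) * (1 + x i ^+ 2 * y j ^+ 2))).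
Proof.
move=> x0 y0.
have -> : \prod_(i < n) (x i ^- (2 * n) * y i ^- (2 * n))
          = \prod_(i < n) \prod_(j < n) (x i ^- 2 * y j ^- 2).
  rewrite big_split /=; under [RHS]eq_bigr do rewrite big_split.
  rewrite big_split [X in _ = _ * X]exchange_big /=; congr (_ * _).
    by apply: eq_bigr => i _; rewrite prodr_const card_ord exprM exprVn.
  by apply: eq_bigr => i _; rewrite prodr_const card_ord exprM exprVn.
rewrite -big_split; apply: eq_bigr => i _; rewrite -big_split.
apply: eq_bigr => j _ /=; have := x0 i; have := y0 j => h1 h2.
by rewrite /sym; field; rewrite h1 h2.
Qed.

Lemma sym1_sqr_exp4 (K : fieldType) (a : K) :
  a != 0 -> a ^+ 4 = -1 -> sym 1 a ^+ 2 = 2%:R.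
Proof.
move=> a0 a4.
have -> : sym 1 a ^+ 2 = 2%:R + (a ^+ 4 + 1) / a ^+ 2 by rewrite /sym; field.
by rewrite a4 addNr mul0r addr0.
Qed.

Lemma eq_Otilde (K : fieldType) N la (w1 w2 : 'I_N -> K) :
  w1 =1 w2 -> Otilde la w1 = Otilde la w2.
Proof.
move=> eq_w; have eq_alt mu : Oalt mu w1 = Oalt mu w2.
  by apply/matrixP => i j; rewrite !mxE eq_w.
by rewrite /Otilde !eq_alt.
Qed.

Lemma generic_point_comp (K : fieldType) N M (w : 'I_N -> K) (f : 'I_M -> 'I_N) :
  generic_point w -> injective f -> generic_point (fun i => w (f i)).
Proof.
rewrite /generic_point; move: 24%N => m [h1 h2 h3] f_inj.
by split=> // i j ne_ij; apply: h2; rewrite (inj_eq f_inj).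
Qed.

Lemma exprz_subn_sqr (K : fieldType) (c : K) n :
  c ^ (- (n ^ 2)%:Z + n%:Z) = c ^- (n * n.-1).
Proof.
by rewrite exprnN; congr (c ^ _); case: n => [|n] //=; lia.
Qed.

Lemma cst_sqrN1 (R : realType) n : cst n (zeta R 4) ^+ 2 = -1.
Proof.
rewrite /cst -rmorphXn -rmorphXn /= (zeta_exp R (k := 2) 2) // zeta2.
by rewrite !rmorphN !rmorph1.
Qed.

(* The factors sigma(a^2)^(2n) and (sigma(b/a) sigma(c/a))^(-n) become 0 and
   1/0 at a = b = c = zeta_4, so the left-hand side of the first identity is the
   value at a = zeta_4 of the rational function A2UU(x, y; a, zeta_4, zeta_4)
   of a. *)
Theorem theorem2p3 (R : realType) (n : nat) (n_gt0 : (1 <= n)%N) :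
  let x := @xvar R n in
  let y := @yvar R n in
  let z4 := cst n (zeta R 4) in
  let z6 := cst n (zeta R 6) in
  let z8 := cst n (zeta R 8) in
  [/\ has_value_at
        (A2UU (fun i => ratcst (x i)) (fun j => ratcst (y j))
              (ratX (ratfun R n)) (ratcst z4) (ratcst z4))
        z4
        (2%:R ^ (- (2 * n ^ 2)%:Z + (2 * n)%:Z)
         * (\prod_(i < n) (x i ^- (2 * n) * y i ^- (2 * n)))
         * (\prod_(i < n) \prod_(j < n)
              ((x i ^+ 2 + y j ^+ 2) * (1 + x i ^+ 2 * y j ^+ 2)))),
      A2UU x y z6 z4 z4
      = 3%:R ^ (- (n ^ 2)%:Z + n%:Z)
        * Otilde (delta_pair n%:Z (n%:Z - 1)) (fcat x y)
    & A2UU x x z8 z4 z4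
      = 2%:R ^ (- (n ^ 2)%:Z + (2 * n)%:Z)
        * Otilde (delta2_pair n%:Z (n%:Z - 2)) x
        * Otilde (delta2_pair (n%:Z - 1) (n%:Z - 1)) x].
Proof.
move=> x y z4 z6 z8.
have gen_w := generic_indet R n; set w := @indet R n in gen_w.
have nat0 m : m%:R != 0 :> ratfun R n = (m != 0)%N by apply: ratfun_nat_neq0.
have z4_sqr : z4 ^+ 2 = -1 by apply: cst_sqrN1.
have w0 := generic_neq0 gen_w.
have x0 i : x i != 0 by apply: w0 (lshift n i).
have y0 i : y i != 0 by apply: w0 (rshift n i).
split.
- rewrite -mulrA -prod_sym2_add //.
  (* The prefactor is a power of 4 because sigma(zeta_4)^2 = -4. *)
  have -> : 2%:R ^ (- (2 * n ^ 2)%:Z + (2 * n)%:Z) = 4%:R ^- (n * n.-1) :> ratfun R n.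
    have -> : 4%:R = 2%:R ^+ 2 :> ratfun R n by rewrite -natrX.
    rewrite -exprM exprnN; congr (_ ^ _).
    by case: (n) => [|m] //=; lia.
  by apply: (has_value_A2UU gen_w); rewrite ?nat0.
- have z6_sqr : z6 ^+ 2 = z6 - 1.
    rewrite /z6 /cst -rmorphXn -rmorphXn /= zeta6_sqr.
    by rewrite rmorphB rmorph1 rmorphB rmorph1.
  have z60 : z6 != 0.
    apply: contra_eq_neq z6_sqr => ->; rewrite expr0n /= add0r eq_sym.
    by rewrite oppr_eq0 oner_eq0.
  have sym_z6 : sym 1 z6 ^+ 2 = 1.
    rewrite -[RHS](expr1n _ 2); congr (_ ^+ 2); apply: (mulfI z60).
    by rewrite /sym mulrDr expr1 mulfV // mulr1 -expr2 z6_sqr subrK.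
  rewrite exprz_subn_sqr.
  have fcatE : fcat x y =1 w by move=> k; rewrite /fcat; case: split_ordP => i ->.
  rewrite (eq_Otilde _ fcatE).
  by apply: (A2UU_sym1_sqr1 gen_w); rewrite ?nat0.
(* Setting y = x leaves a subfamily of the indeterminates, which is still generic. *)
have gen_x : generic_point x := generic_point_comp gen_w (@lshift_inj n n).
have z8_sqr : z8 ^+ 2 = z4.
  by rewrite /z8 /z4 /cst -rmorphXn -rmorphXn /= (zeta_exp R (k := 2) 4).
have z80 : z8 != 0.
  apply: contra_eq_neq z4_sqr => z8_eq; rewrite -z8_sqr z8_eq !expr0n /=.
  by rewrite eq_sym oppr_eq0 oner_eq0.
have sym_z8 : sym 1 z8 ^+ 2 = 2%:R.
  by apply: sym1_sqr_exp4 => //; rewrite (exprM _ 2 2) z8_sqr.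
have -> : 2%:R ^ (- (n ^ 2)%:Z + (2 * n)%:Z) = 2%:R ^- (n * n.-1) * 2%:R ^+ n :> ratfun R n.
  rewrite -exprz_subn_sqr -[2%:R ^+ n]/(2%:R ^ n%:Z) -expfzDr ?nat0 //.
  by congr (_ ^ _); lia.
by apply: A2UU_sym1_sqr2; rewrite ?nat0.
Qed.
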